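(* Fix $1\le q\le\infty$, $0<\varepsilon<1$, $c>0$, $\lambda\in[1/2,2]$, $m_2>0$, an integer $1\le s\le p$, and a set $\Omega$ of $n\times p$ matrices. Let $\mathcal{P}$ be the class of probability distributions $\mathbf{P}_X$ on the set of $n\times p$ matrices $X=(X_{ij})$ such that $$\mathbf{P}_X\Big[\kappa_q(s,1+\lambda)\ge c s^{-1/q},\ \ \max_{j=1,\dots,p}\frac1n\sum_{i=1}^nX_{ij}^2\le m_2,\ \ X\in\Omega\Big]\ge1-\varepsilon .$$ Let $X$ be a random matrix with distribution $\mathbf{P}_X\in\mathcal{P}$, and assume that the conditional distribution of $(\xi,W)$ given $X$ is such that (A2)--(A4) of the context are satisfied conditionally on $X$, with fixed constants $c_b$ and $c_b'$ (and fixed $\sigma,\sigma_*$), for all $X\in\Omega$. Assume that the true parameter $\theta^*\in\Theta\subset\mathbb{R}^p$ is $s$-sparse (at most $s$ nonzero components), that $$s\le c_1(\lambda^{-1}+\lambda)^{-1}\sqrt{n/\log(p/\varepsilon)}$$ for some small enough constant $c_1>0$, and set $\mu=\delta_1'(\varepsilon)+\delta_4'(\varepsilon)+\delta_5(\varepsilon)+b(\varepsilon)$, $\tau=\delta_2(\varepsilon)+\delta_3(\varepsilon)$. Let $(\hat\theta,\hat t)$ be a solution of the conic programming problem in the context. Then, with probability at least $1-9\varepsilon$, $$|\hat\theta-\theta^*|_q\le C s^{1/q}\sqrt{\frac{\log(c'p/\varepsilon)}{n}}\,\big(|\theta^*|_2+1\big)\quad(\text{with } s^{1/\infty}=1)$$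 and $$\frac1n\big|X(\hat\theta-\theta^* )\big|_2^2\le C s\,\frac{\log(c'p/\varepsilon)}{n}\,\big(|\theta^*|_2+1\big)^2 ,$$ where $C>0$, $c'>0$, and the smallness threshold for $c_1$, depend only on $m_2,\sigma,\sigma_*,c_b,c_b'$ and $c$.
   Context: Notation: $|\cdot|_q$ is the $\ell_q$-norm of vectors; for a matrix, $|\cdot|_\infty$ is the largest absolute value of its entries. A random variable $\eta$ is $\gamma$-subgaussian (subgaussian with variance parameter $\gamma^2$) if $\mathbb{E}[\exp(t\eta)]\le\exp(\gamma^2t^2/2)$ for all $t\in\mathbb{R}$; a random vector $\zeta\in\mathbb{R}^p$ is $\gamma$-subgaussian if $(\zeta,v)$ is $\gamma$-subgaussian for every $v$ with $|v|_2=1$. For a square matrix $A$, $\mathrm{Diag}\{A\}$ keeps the diagonal of $A$ and sets the off-diagonal elements to zero. Model: $y=X\theta^*+\xi$, $Z=X+W$, where $y\in\mathbb{R}^n$ and the $n\times p$ matrix $Z$ are observed, $X$ is an unobserved $n\times p$ matrix, $W=(W_{ij})$ is an $n\times p$ random noise matrix, $\xi\in\mathbb{R}^n$ is a random noise vector, and $\theta^*\in\mathbb{R}^p$ is unknown. $\Psi=\frac1nX^TX$. Assumptions (to hold under the conditional distribution of $(\xi,W)$ given $X$; expectations and probabilities below are conditional on $X$). (A2) The elements of $\xi$ are independent zero-mean subgaussian with variance parameter $\sigma^2$. (A3) The rows of $W$ are independent zero-mean subgaussian random vectors with variance parameter $\sigma_*^2$, $\mathbb{E}(W_{ij}W_{ik})=0$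 for all $1\le j<k\le p$, and $W$ is independent of $\xi$. (A4) With $\sigma_j^2=\frac1n\sum_{i=1}^n\mathbb{E}(W_{ij}^2)$, there are statistics $\hat\sigma_j^2$ such that for any $\varepsilon>0$, $\mathbb{P}[\max_{j}|\hat\sigma_j^2-\sigma_j^2|\ge b(\varepsilon)]\le\varepsilon$, where $b(\varepsilon)=c_b\sqrt{\log(c_b'p/\varepsilon)/n}$ for constants $c_b,c_b'>0$ (it is understood that $b(\varepsilon)$ is well defined, i.e. $c_b'p/\varepsilon\ge1$, for the $\varepsilon$ considered). Let $\widehat D$ and $D$ be the diagonal matrices with entries $\hat\sigma_j^2$ and $\sigma_j^2$ respectively. Noise levels (with $m_2$ the fixed constant of the statement): $\delta_2(\varepsilon)=\sigma\sqrt{2m_2\log(2p/\varepsilon)/n}$; $\delta_3(\varepsilon)=\delta_5(\varepsilon)=\max\big(\gamma_0\sqrt{2\log(2p/\varepsilon)/n},\ 2\log(2p/\varepsilon)/(t_0n)\big)$; $\delta_4(\varepsilon)=\max\big(\gamma_0\sqrt{2\log(p(p-1)/\varepsilon)/n},\ 2\log(p(p-1)/\varepsilon)/(t_0n)\big)$; $\delta_1'(\varepsilon)=\sigma_*\sqrt{2m_2\log(2p/\varepsilon)/n}$; $\delta_4'(\varepsilon)=\max\big(\gamma_2\sqrt{2\log(2p/\varepsilon)/n},\ 2\log(2p/\varepsilon)/(t_2n)\big)$. Here $\gamma_0,t_0>0$ depend only on $\sigma,\sigma_*$ and $\gamma_2,t_2>0$ depend only on $\sigma_*$; they are constants such that,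 whenever $X$ is deterministic (or one conditions on $X$) and (A2)--(A3) hold, each of the following inequalities holds with probability at least $1-\varepsilon$: $|\frac1nW^T\xi|_\infty\le\delta_3(\varepsilon)$, $|\frac1n(W^TW-\mathrm{Diag}\{W^TW\})|_\infty\le\delta_4(\varepsilon)$, $|\frac1n\mathrm{Diag}\{W^TW\}-D|_\infty\le\delta_5(\varepsilon)$, $|\frac1n(W^TW-\mathrm{Diag}\{W^TW\})\theta^*|_\infty\le\delta_4'(\varepsilon)|\theta^*|_2$. Conic programming estimator: $\hat\theta$ is the first component of a solution $(\hat\theta,\hat t)$ of: minimise $|\theta|_1+\lambda t$ over $(\theta,t)$ such that $\theta\in\Theta$, $t\in\mathbb{R}^+=[0,\infty)$, $\big|\frac1nZ^T(y-Z\theta)+\widehat D\theta\big|_\infty\le\mu t+\tau$, $|\theta|_2\le t$. (A minimiser is understood to exist when the feasible set is nonempty; otherwise $(\hat\theta,\hat t)$ is arbitrary.) Sensitivity: for $J\subset\{1,\dots,p\}$, $\Delta_J$ is the vector with the coordinates of $\Delta$ on $J$ and zeros elsewhere; $C_J(u)=\{\Delta\in\mathbb{R}^p:|\Delta_{J^c}|_1\le u|\Delta_J|_1\}$; $\kappa_q(s,u)=\min_{J:|J|\le s}\min_{\Delta\in C_J(u):|\Delta|_q=1}|\Psi\Delta|_\infty$ (a minimum over the empty set is $+\infty$). *)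

(* Defs.v *)
From HB Require Import structures.
From mathcomp Require Export all_boot all_order all_algebra.
From mathcomp Require Export all_classical all_reals all_analysis.
From mathcomp Require Export measurable_realfun.
Export Order.TTheory GRing.Theory Num.Theory.
Export numFieldNormedType.Exports.

Set Implicit Arguments.
Unset Strict Implicit.
Unset Printing Implicit Defensive.

#[global] Open Scope classical_set_scope.
#[global] Open Scope ring_scope.

(* Matrices carry the sigma-algebra generated by their entries, which for real
   entries is the Borel sigma-algebra of R^(m * n). *)
Definition measure_matrix_display : measure_display -> measure_display.
Proof. exact. Qed.

Section measurable_matrix.
Context {d} {T : sigmaRingType d}.
Variables m n : nat.

Definition matrix_measurable : set_system 'M[T]_(m, n) :=
  <<s \bigcup_(ij in [set: 'I_m * 'I_n])
        preimage_set_system setT (fun A : 'M[T]_(m, n) => A ij.1 ij.2)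
          measurable >>.

Let matrix_set0 : matrix_measurable set0.
Proof. exact: sigma_algebra0. Qed.

Let matrix_setC A : matrix_measurable A -> matrix_measurable (~` A).
Proof. exact: sigma_algebraC. Qed.

Let matrix_bigcup (F : (set 'M[T]_(m, n))^nat) :
  (forall i, matrix_measurable (F i)) -> matrix_measurable (\bigcup_i (F i)).
Proof. exact: sigma_algebra_bigcup. Qed.

HB.instance Definition _ := @isMeasurable.Build (measure_matrix_display d)
  'M[T]_(m, n) matrix_measurable matrix_set0 matrix_setC matrix_bigcup.

End measurable_matrix.

Section vectors.
Context {R : realType}.

(* The library norm `|A| of a matrix or vector is its largest absolute entry. *)
Definition lnorm (q : \bar R) {p : nat} (v : 'cV[R]_p) : R :=
  match q with
  | r%:E => (\sum_i `|v i 0| `^ r) `^ r^-1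
  | +oo%E => `|v|
  | -oo%E => 0
  end.

Definition nnz {p : nat} (v : 'cV[R]_p) : nat := #|[set i | v i 0 != 0]|.

Definition restrict {p : nat} (J : {set 'I_p}) (v : 'cV[R]_p) : 'cV[R]_p :=
  \col_i (if i \in J then v i 0 else 0).

Definition Diag {p : nat} (A : 'M[R]_p) : 'M[R]_p := diag_mx (\row_j A j j).

Definition gram {n p : nat} (X : 'M[R]_(n, p)) : 'M[R]_p :=
  n%:R^-1 *: (X^T *m X).

Definition cone {p : nat} (J : {set 'I_p}) (u : R) : set 'cV[R]_p :=
  [set v | lnorm 1%:E (restrict (~: J) v) <= u * lnorm 1%:E (restrict J v)].

(* The minima are attained whenever the sets are nonempty, and [ereal_inf] of
   the empty set is +oo. *)
Definition sensitivity (q : \bar R) (s : nat) (u : R) {p : nat}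
    (Psi : 'M[R]_p) : \bar R :=
  ereal_inf [set ereal_inf [set (`|Psi *m v|)%:E |
                              v in cone J u `&` [set v | lnorm q v = 1]] |
               J in [set J : {set 'I_p} | (#|J| <= s)%N]].

End vectors.

Section probability_notions.
Context {d} {T : measurableType d} {R : realType}.
Implicit Type P : probability T R.

(* "[A] holds with probability at least [a]": for measurable [A] this is
   a <= P A; otherwise it is the corresponding inner-probability statement. *)
Definition prob_ge P (A : set T) (a : R) : Prop :=
  exists B : set T, [/\ measurable B, B `<=` A & (a%:E <= P B)%E].

Definition subgaussian P (gamma : R) (eta : T -> R) : Prop :=
  forall t : R,
    ('E_P[fun w => expR (t * eta w)] <= (expR (gamma ^+ 2 * t ^+ 2 / 2))%:E)%E.

Definition subgaussian_vector P (gamma : R) {p : nat}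
    (zeta : T -> 'rV[R]_p) : Prop :=
  forall v : 'cV[R]_p, lnorm 2%:E v = 1 ->
    subgaussian P gamma (fun w => (zeta w *m v) 0 0).

Definition mutually_independent P {d'} {T' : measurableType d'}
    {I : finType} (Y : I -> T -> T') : Prop :=
  forall (J : {set I}) (A : I -> set T'), (forall i, measurable (A i)) ->
    P (\bigcap_(i in [set` J]) (Y i @^-1` A i)) =
    (\prod_(i in J) P (Y i @^-1` A i))%E.

Definition independent P {d1 d2} {T1 : measurableType d1}
    {T2 : measurableType d2} (Y1 : T -> T1) (Y2 : T -> T2) : Prop :=
  forall A B, measurable A -> measurable B ->
    P (Y1 @^-1` A `&` Y2 @^-1` B) = (P (Y1 @^-1` A) * P (Y2 @^-1` B))%E.

(* [K] is a regular conditional distribution of [Y] given [X]. *)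
Definition conditional_distribution P {d1 d2} {T1 : measurableType d1}
    {T2 : measurableType d2} (X : {RV P >-> T1}) (Y : {RV P >-> T2})
    (K : T1 -> probability T2 R) : Prop :=
  (forall B, measurable B -> measurable_fun setT (fun x => K x B)) /\
  (forall A B, measurable A -> measurable B ->
     P (X @^-1` A `&` Y @^-1` B) = \int[distribution P X]_(x in A) K x B)%E.

Definition response_noise P (sigma : R) {n : nat} (xi : T -> 'cV[R]_n) :
    Prop :=
  [/\ mutually_independent P (fun i w => xi w i 0),
      forall i, ('E_P[fun w => xi w i 0%R] = 0)%E &
      forall i, subgaussian P sigma (fun w => xi w i 0)].

Definition design_noise P (sigmaW : R) {n p : nat} (xi : T -> 'cV[R]_n)
    (W : T -> 'M[R]_(n, p)) : Prop :=
  [/\ mutually_independent P (fun i w => row i (W w)),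
      forall i j, ('E_P[fun w => W w i j] = 0)%E,
      forall i, subgaussian_vector P sigmaW (fun w => row i (W w)),
      forall i (j k : 'I_p), (j < k)%N ->
        ('E_P[fun w => (W w i j * W w i k)%R] = 0)%E &
      independent P W xi].

(* The row vector of the sigma_j^2. *)
Definition noise_var P {n p : nat} (W : T -> 'M[R]_(n, p)) : 'rV[R]_p :=
  \row_j (n%:R^-1 * \sum_i fine 'E_P[fun w => (W w i j ^+ 2)%R]%E).

Definition var_rate (cb cb' : R) (n p : nat) (eps : R) : R :=
  cb * Num.sqrt (ln (cb' * p%:R / eps) / n%:R).

(* [1 <= cb' * p / eps] is what makes [var_rate] meaningful: below it the
   logarithm is negative and [Num.sqrt] returns 0. *)
Definition var_estimator P (cb cb' : R) {n p : nat} (W : T -> 'M[R]_(n, p))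
    (sig2 : T -> 'rV[R]_p) : Prop :=
  forall eps : R, 0 < eps -> 1 <= cb' * p%:R / eps ->
    (P [set w | (var_rate cb cb' n p eps <= `|sig2 w - noise_var P W|)%R]
      <= eps%:E)%E.

End probability_notions.

Section rates.
Context {R : realType}.

Definition linear_rate (sigma m2 : R) (n p : nat) (eps : R) : R :=
  sigma * Num.sqrt (2 * m2 * ln (2 * p%:R / eps) / n%:R).

Definition bernstein_rate (gamma t : R) (n : nat) (L : R) : R :=
  Num.max (gamma * Num.sqrt (2 * L / n%:R)) (2 * L / (t * n%:R)).

Definition delta1' (sigmaW m2 : R) := linear_rate sigmaW m2.

Definition delta2 (sigma m2 : R) := linear_rate sigma m2.

Definition delta3 (gamma0 t0 : R) (n p : nat) (eps : R) : R :=
  bernstein_rate gamma0 t0 n (ln (2 * p%:R / eps)).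

Definition delta4 (gamma0 t0 : R) (n p : nat) (eps : R) : R :=
  bernstein_rate gamma0 t0 n (ln (p%:R * (p%:R - 1) / eps)).

Definition delta4' (gamma2 t2 : R) (n p : nat) (eps : R) : R :=
  bernstein_rate gamma2 t2 n (ln (2 * p%:R / eps)).

Definition delta5 (gamma0 t0 : R) := delta3 gamma0 t0.

(* [gamma0], [t0] are functions of (sigma, sigmaW), and [gamma2], [t2] of
   sigmaW, so that they cannot depend on anything else. When p = 1 the matrix
   bounded by [delta4] vanishes, and so does [delta4] since ln 0 = 0. *)
Definition noise_constants (gamma0 t0 : R -> R -> R) (gamma2 t2 : R -> R) :
    Prop :=
  forall sigma sigmaW : R, 0 <= sigma -> 0 <= sigmaW ->
  let g0 := gamma0 sigma sigmaW in
  let u0 := t0 sigma sigmaW in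
  let g2 := gamma2 sigmaW in
  let u2 := t2 sigmaW in
  [/\ 0 < g0, 0 < u0, 0 < g2, 0 < u2 &
   forall (n p : nat) (eps : R) (d : measure_display) (T : measurableType d)
     (P : probability T R) (xi : {RV P >-> 'cV[R]_n})
     (W : {RV P >-> 'M[R]_(n, p)}) (theta : 'cV[R]_p),
   (0 < n)%N -> (0 < p)%N -> 0 < eps < 1 ->
   response_noise P sigma xi -> design_noise P sigmaW xi W ->
   let G w := (W w)^T *m W w in
   [/\ prob_ge P [set w | `|n%:R^-1 *: ((W w)^T *m xi w)|
         <= delta3 g0 u0 n p eps] (1 - eps),
       prob_ge P [set w | `|n%:R^-1 *: (G w - Diag (G w))|
         <= delta4 g0 u0 n p eps] (1 - eps),
       prob_ge P [set w | `|n%:R^-1 *: Diag (G w) - diag_mx (noise_var P W)|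
         <= delta5 g0 u0 n p eps] (1 - eps) &
       prob_ge P [set w | `|n%:R^-1 *: ((G w - Diag (G w)) *m theta)|
         <= delta4' g2 u2 n p eps * lnorm 2%:E theta] (1 - eps)]].

End rates.

Section conic_program.
Context {R : realType} {n p : nat}.
Variables (Theta : set 'cV[R]_p) (y : 'cV[R]_n) (Z : 'M[R]_(n, p)).
Variables (sig2 : 'rV[R]_p) (mu tau lambda : R).

Definition conic_feasible (theta : 'cV[R]_p) (t : R) : Prop :=
  [/\ Theta theta, 0 <= t,
      `|n%:R^-1 *: (Z^T *m (y - Z *m theta)) + diag_mx sig2 *m theta|
        <= mu * t + tau &
      lnorm 2%:E theta <= t].

Definition conic_objective (theta : 'cV[R]_p) (t : R) : R :=
  lnorm 1%:E theta + lambda * t.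

(* Nothing is required of the pair when the program is infeasible. *)
Definition conic_solution (theta : 'cV[R]_p) (t : R) : Prop :=
  (exists theta' t', conic_feasible theta' t') ->
  conic_feasible theta t /\
  forall theta' t', conic_feasible theta' t' ->
    conic_objective theta t <= conic_objective theta' t'.

End conic_program.

(* [fine q^-1] is 1/q, equal to 0 when q = +oo. *)
Definition design_class {R : realType} {n p : nat} (q : \bar R) (s : nat)
    (eps c lambda m2 : R) (Omega : set 'M[R]_(n, p))
    (PX : probability 'M[R]_(n, p) R) : Prop :=
  prob_ge PX
    [set X | [/\ ((c * s%:R `^ (- fine q^-1%E))%:E
                    <= sensitivity q s (1 + lambda) (gram X))%E,
                 forall j, n%:R^-1 * \sum_i X i j ^+ 2 <= m2 &
                 Omega X]]
    (1 - eps).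

(* [Q] is a law of (xi, W, sig2). *)
Definition noise_law {R : realType} {n p : nat} (sigma sigmaW cb cb' : R)
    (Q : probability ('cV[R]_n * 'M[R]_(n, p) * 'rV[R]_p)%type R) : Prop :=
  [/\ response_noise Q sigma (fun e => e.1.1),
      design_noise Q sigmaW (fun e => e.1.1) (fun e => e.1.2) &
      var_estimator Q cb cb' (fun e => e.1.2) (fun e => e.2)].

(* Main.v *)
From HB Require Import structures.
Require Import Defs.
From mathcomp Require Import ring lra.

Set Implicit Arguments.
Unset Strict Implicit.
Unset Printing Implicit Defensive.

(** The argument has a deterministic half and a probabilistic half, joined by
    one event on the pair (design, noise).

    Deterministic half.  Write Delta for the estimation error, J for the support
    of the true parameter and Psi for the Gram matrix.  When the noise is small
    in the sense of [noise_event], the true parameter together with its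
    Euclidean norm is feasible ([residual_true_le]): replacing X by Z biases the
    normal equations by the diagonal of W^T W / n, and the estimated variances
    remove precisely that bias.  Minimality then puts Delta in a cone around J
    ([conic_cone]) and bounds the auxiliary variable ([conic_t_le]); as both the
    solution and the true parameter satisfy the constraint, Psi Delta is bounded
    in sup-norm by 2 (mu |theta*|_2 + tau) plus a small multiple of |Delta|_1
    ([conic_gram_le]).  The sensitivity and Hoelder's inequality on J give
    |Delta|_1 <= (4 s / c) |Psi Delta|_oo, so that under the sparsity assumption
    the second term is at most half of the left-hand side and is absorbed
    ([conic_error]).

    Probabilistic half.  For a fixed design with bounded column norms, the noise
    event is an intersection of eight events of probability at least 1 - eps
    ([noise_law_event]): four are the defining property of the noise constants,
    one is the property of the variance estimators, and the three that involve
    both the design and the noise are maxima of subgaussian variables, for which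
    independence is needed in the form E prod = prod E
    ([mutually_independent_integral_prod]).  The bound is then integrated over
    the good designs, the ninth event, by disintegrating the joint law
    ([conditional_distribution_prob_ge]).

    If eps >= 1/9 the claimed probability is nonpositive and there is nothing to
    prove.  Otherwise ln (p / eps) >= 1, so constants inside logarithms turn into
    constants in front of them, and the sparsity assumption forces
    sqrt (ln (p / eps) / n) <= 1, so the linear branch of each Bernstein-type
    level is dominated by that rate too: all levels are multiples of one rate
    ([noise_levels_le]), and the constant inside the logarithm can be 1. *)

(** * Norms and the sensitivity *)

Section norms.
Context {R : realType}.

Lemma lnorm1E p (v : 'cV[R]_p) : lnorm 1%:E v = \sum_i `|v i 0|.
Proof.
rewrite /lnorm invr1 powRr1; last by apply: sumr_ge0 => i _; exact: powR_ge0.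
by apply: eq_bigr => i _; rewrite powRr1.
Qed.

Lemma lnorm2E p (v : 'cV[R]_p) : lnorm 2%:E v = Num.sqrt (\sum_i v i 0 ^+ 2).
Proof.
rewrite /lnorm powR12_sqrt; last by apply: sumr_ge0 => i _; exact: powR_ge0.
congr Num.sqrt; apply: eq_bigr => i _.
by rewrite powR_mulrn// real_normK ?num_real.
Qed.

Lemma lnorm_ge0 q p (v : 'cV[R]_p) : 0 <= lnorm q v.
Proof. by case: q => [r| |] //=; exact: powR_ge0. Qed.

Lemma mx_norm_leP m n (A : 'M[R]_(m, n)) r : 0 <= r ->
  (forall i j, `|A i j| <= r) <-> `|A| <= r.
Proof.
move=> r0; rewrite [`|A|]mx_normrE; split=> [Ar|/bigmax_leP[_ Ar] i j].
  by apply/bigmax_leP; split => // -[i j] _; exact: Ar.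
exact: (Ar (i, j)).
Qed.

Lemma le_mx_norm m n (A : 'M[R]_(m, n)) i j : `|A i j| <= `|A|.
Proof. by apply: (mx_norm_leP A (normr_ge0 A)).2. Qed.

Lemma mx_norm_trmx m n (A : 'M[R]_(m, n)) : `|A^T| = `|A|.
Proof.
apply/eqP; rewrite eq_le; apply/andP; split; apply/mx_norm_leP => // i j.
  by rewrite mxE le_mx_norm.
by have := le_mx_norm A^T j i; rewrite mxE.
Qed.

Lemma norm_inner_le p (u : 'rV[R]_p) (v : 'cV[R]_p) :
  `|(u *m v) 0 0| <= `|u| * lnorm 1%:E v.
Proof.
rewrite mxE lnorm1E mulr_sumr; apply: le_trans (ler_norm_sum _ _ _) _.
by apply: ler_sum => i _; rewrite normrM ler_wpM2r// le_mx_norm.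
Qed.

Lemma mx_norm_mulmx_le m p (A : 'M[R]_(m, p)) (v : 'cV[R]_p) :
  `|A *m v| <= `|A| * lnorm 1%:E v.
Proof.
apply/mx_norm_leP => [|i j]; first by rewrite mulr_ge0// lnorm_ge0.
rewrite (ord1 j) (_ : (A *m v) i 0 = (row i A *m v) 0 0); last first.
  by rewrite -row_mul [RHS]mxE.
apply: le_trans (norm_inner_le _ _) _; rewrite ler_wpM2r ?lnorm_ge0//.
by apply/mx_norm_leP => // k l; rewrite mxE le_mx_norm.
Qed.

Lemma mx_norm_diag_mulmx_le p (d : 'rV[R]_p) (v : 'cV[R]_p) :
  `|diag_mx d *m v| <= `|diag_mx d| * `|v|.
Proof.
apply/mx_norm_leP => [|i j]; first by rewrite mulr_ge0.
rewrite mul_diag_mx mxE normrM ler_pM// ?le_mx_norm//.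
by have := le_mx_norm (diag_mx d) i i; rewrite mxE eqxx mulr1n.
Qed.

Lemma mx_norm_le_lnorm2 p (v : 'cV[R]_p) : `|v| <= lnorm 2%:E v.
Proof.
apply/mx_norm_leP => [|i j]; first exact: lnorm_ge0.
rewrite (ord1 j) lnorm2E -sqrtr_sqr ler_wsqrtr// (bigD1 i)//= lerDl.
by apply: sumr_ge0 => k _; exact: sqr_ge0.
Qed.

Lemma lnorm2_sqr p (v : 'cV[R]_p) : lnorm 2%:E v ^+ 2 = (v^T *m v) 0 0.
Proof.
rewrite lnorm2E sqr_sqrtr; last by apply: sumr_ge0 => i _; exact: sqr_ge0.
by rewrite mxE; apply: eq_bigr => i _; rewrite mxE expr2.
Qed.

(** Expanding the square, the cross term is at most 2 |u|_2 |v|_1 because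
    |u|_oo <= |u|_2.  The l_1 norm on the right is what the cone condition can
    absorb. *)
Lemma lnorm2D_le p (u v : 'cV[R]_p) :
  lnorm 2%:E (u + v) <= lnorm 2%:E u + lnorm 1%:E v.
Proof.
rewrite -(@ler_pXn2r _ 2) ?nnegrE ?addr_ge0 ?lnorm_ge0//.
have sq w : lnorm 2%:E w ^+ 2 = \sum_i w i 0 ^+ 2 :> R.
  by rewrite lnorm2E sqr_sqrtr//; apply: sumr_ge0 => i _; exact: sqr_ge0.
have uv i : u i 0 * v i 0 <= lnorm 2%:E u * `|v i 0|.
  apply: le_trans (ler_norm _) _; rewrite normrM ler_wpM2r//.
  exact: le_trans (le_mx_norm _ _ _) (mx_norm_le_lnorm2 _).
have vv i : v i 0 ^+ 2 <= lnorm 1%:E v * `|v i 0|.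
  rewrite -real_normK ?num_real// expr2 ler_wpM2r// lnorm1E (bigD1 i)//= lerDl.
  exact: sumr_ge0.
have Huv : \sum_i u i 0 * v i 0 <= lnorm 2%:E u * lnorm 1%:E v.
  rewrite [X in _ <= _ * X]lnorm1E mulr_sumr.
  by apply: ler_sum => i _; exact: uv.
have Hvv : \sum_i v i 0 ^+ 2 <= lnorm 1%:E v * lnorm 1%:E v.
  rewrite [X in _ <= _ * X]lnorm1E mulr_sumr.
  by apply: ler_sum => i _; exact: vv.
have squ := sq _ u; rewrite sq.
have -> : \sum_i (u + v) i 0 ^+ 2 = \sum_i u i 0 ^+ 2
    + (\sum_i u i 0 * v i 0) *+ 2 + \sum_i v i 0 ^+ 2.
  rewrite -sumrMnl -!big_split/=; apply: eq_bigr => i _.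
  by rewrite mxE sqrrD.
rewrite -squ; move: Huv Hvv.
move: (lnorm 2%:E u) (lnorm 1%:E v) (\sum_i _) (\sum_i _) => a b x y xab yb.
by rewrite sqrrD -expr2 in yb *; rewrite lerD// lerD// lerMn2r xab orbT.
Qed.

Lemma lnorm_eq0 q p (v : 'cV[R]_p) : (1 <= q)%E -> lnorm q v = 0 -> v = 0.
Proof.
case: q => [r| |] //=; last by move=> _ /eqP; rewrite normr_eq0 => /eqP.
rewrite lee_fin => r1 /powR_eq0_eq0 /eqP.
rewrite psumr_eq0 => [/allP v0|i _]; last exact: powR_ge0.
apply/colP => i; rewrite mxE; have := v0 i (mem_index_enum i) => /eqP.
by move/powR_eq0_eq0/eqP; rewrite normr_eq0 => /eqP.
Qed.

Lemma lnormZ q p (a : R) (v : 'cV[R]_p) : (1 <= q)%E ->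
  lnorm q (a *: v) = `|a| * lnorm q v.
Proof.
case: q => [r| |] //=; last by rewrite normrZ.
rewrite lee_fin => r1; have r0 : r != 0 by rewrite gt_eqF// (lt_le_trans _ r1).
under eq_bigr do rewrite mxE normrM powRM//.
rewrite -mulr_sumr powRM ?powR_ge0//; last first.
  by apply: sumr_ge0 => i _; exact: powR_ge0.
by rewrite -powRrM mulfV// powRr1.
Qed.

Lemma lnorm1_restrict p (J : {set 'I_p}) (v : 'cV[R]_p) :
  lnorm 1%:E (restrict J v) = \sum_(i in J) `|v i 0|.
Proof.
rewrite lnorm1E [RHS]big_mkcond/=; apply: eq_bigr => i _.
by rewrite mxE; case: ifP => // _; rewrite normr0.
Qed.

Lemma lnorm1_split p (J : {set 'I_p}) (v : 'cV[R]_p) :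
  lnorm 1%:E v = lnorm 1%:E (restrict J v) + lnorm 1%:E (restrict (~: J) v).
Proof.
rewrite !lnorm1_restrict lnorm1E (bigID (mem J))/=; congr (_ + _).
by apply: eq_bigl => i; rewrite inE.
Qed.

(** Hoelder's inequality on J with the factor s^(1 - 1/q) split between the two
    sides, so that no power has to be recombined: the s^(1/q) on the left meets
    the s^(-1/q) of the sensitivity assumption. *)
Lemma lnorm1_restrict_le q p (J : {set 'I_p}) s (v : 'cV[R]_p) :
  (1 <= q)%E -> (#|J| <= s)%N ->
  lnorm 1%:E (restrict J v) * s%:R `^ (fine q^-1%E) <= s%:R * lnorm q v.
Proof.
move=> q1 Js; rewrite lnorm1_restrict.
have JsR : #|J|%:R <= s%:R :> R by rewrite ler_nat.
case: q q1 => [r| |] //=; last first.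
  move=> _; rewrite powRr0 mulr1.
  apply: (@le_trans _ _ (\sum_(i in J) `|v|)).
    by apply: ler_sum => i _; exact: le_mx_norm.
  by rewrite sumr_const -[leLHS]mulr_natl ler_wpM2r.
rewrite lee_fin => r1.
have r0 : 0 < r by exact: lt_le_trans r1.
rewrite fine_invr.
set N := (X in _ <= _ * X).
have [N0|N0] := eqVneq N 0.
  have v0 : v = 0 by exact: (@lnorm_eq0 r%:E).
  have -> : \sum_(i in J) `|v i 0| = 0.
    by rewrite v0 big1// => i _; rewrite mxE normr0.
  by rewrite N0 mul0r mulr0.
have {}N0 : 0 < N by rewrite lt_neqAle eq_sym N0 powR_ge0.
have Nr : N `^ r = \sum_i `|v i 0| `^ r.
  rewrite /N -powRrM mulVf ?gt_eqF// powRr1//.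
  by apply: sumr_ge0 => i _; exact: powR_ge0.
set k := s%:R : R.
have k0 : 0 <= k by rewrite /k.
(* With this scaling the r-th powers of the [a i] sum to at most k over J, and
   Young's inequality a <= a^r / r + (1 - 1/r) can be summed over J. *)
pose a i := `|v i 0| / N * k `^ r^-1.
have a0 i : 0 <= a i by rewrite mulr_ge0 ?powR_ge0 ?divr_ge0// ltW.
have ai i : a i <= a i `^ r / r + (1 - r^-1).
  have [rE|rN1] := eqVneq r 1.
    by rewrite rE invr1 subrr addr0 powRr1// mulr1.
  have r1' : 1 < r by rewrite lt_neqAle eq_sym rN1.
  have ri : 0 < 1 - r^-1 by rewrite subr_gt0 invf_lt1.
  have := @conjugate_powR _ (a i) 1 r (1 - r^-1)^-1 (a0 i) ler01 r0.
  rewrite invr_gt0 invrK powR1 mul1r mulr1; apply => //.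
  by rewrite addrC subrK.
have aE i : a i `^ r = `|v i 0| `^ r / N `^ r * k.
  have N0' := ltW N0.
  have Ninv : N^-1 `^ r = (N `^ r)^-1.
    by rewrite -[N^-1]powR_inv1// -powRrM mulN1r powRN.
  rewrite /a powRM ?divr_ge0 ?powR_ge0// -powRrM mulVf ?gt_eqF// powRr1//.
  by rewrite powRM ?invr_ge0// Ninv.
have sa : \sum_(i in J) a i <= k.
  apply: (@le_trans _ _ (\sum_(i in J) (a i `^ r / r + (1 - r^-1)))).
    by apply: ler_sum => i _; exact: ai.
  rewrite big_split/= sumr_const -mulr_suml.
  have H1 : \sum_(i in J) a i `^ r <= k.
    under eq_bigr do rewrite aE.
    rewrite -!mulr_suml -[leRHS]mul1r ler_wpM2r//.
    rewrite ler_pdivrMr ?(powR_gt0 r N0)// mul1r Nr [leRHS](bigID (mem J))/= lerDl.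
    by apply: sumr_ge0 => i _; exact: powR_ge0.
  have H2 : (1 - r^-1) *+ #|J| <= k * (1 - r^-1).
    by rewrite -mulr_natl ler_wpM2r// subr_ge0 invf_le1.
  apply: (le_trans (lerD (ler_wpM2r _ H1) H2)); first by rewrite invr_ge0 ltW.
  by rewrite -mulrDr addrC subrK mulr1.
rewrite (_ : _ * _ = (\sum_(i in J) a i) * N); first by rewrite ler_wpM2r// ltW.
rewrite !mulr_suml; apply: eq_bigr => i _.
by rewrite /a mulrAC divfK// gt_eqF.
Qed.

(** The cone and both sides are homogeneous in v, whereas the sensitivity only
    looks at vectors of unit l_q norm. *)
Lemma sensitivity_le q s p (u : R) (Psi : 'M[R]_p) (kappa : R)
    (J : {set 'I_p}) (v : 'cV[R]_p) :
  (1 <= q)%E -> (kappa%:E <= sensitivity q s u Psi)%E -> (#|J| <= s)%N ->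
  cone J u v -> kappa * lnorm q v <= `|Psi *m v|.
Proof.
move=> q1 Hk Js Jv.
have [N0|N0] := eqVneq (lnorm q v) 0; first by rewrite N0 mulr0.
set N := lnorm q v in N0 *.
have {}N0 : 0 < N by rewrite lt_neqAle eq_sym N0 lnorm_ge0.
have coneZ : cone J u (N^-1 *: v).
  have rZ (I : {set 'I_p}) : restrict I (N^-1 *: v) = N^-1 *: restrict I v.
    by apply/colP => i; rewrite !mxE; case: ifP => // _; rewrite mulr0.
  suff : lnorm 1%:E (restrict (~: J) (N^-1 *: v)) <=
      u * lnorm 1%:E (restrict J (N^-1 *: v)) by [].
  by rewrite !rZ !lnormZ// mulrCA ler_wpM2l.
have : (kappa%:E <= (`|Psi *m (N^-1 *: v)|)%:E)%E.
  apply: le_trans Hk _; apply: (@le_trans _ _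
      (ereal_inf [set (`|Psi *m v|)%:E |
        v in cone J u `&` [set v | lnorm q v = 1]])).
    by apply: ereal_inf_lbound; exists J.
  apply: ereal_inf_lbound; exists (N^-1 *: v) => //; split => //=.
  by rewrite lnormZ// gtr0_norm ?invr_gt0// mulVf// gt_eqF.
rewrite lee_fin -scalemxAr normrZ gtr0_norm ?invr_gt0//.
by rewrite [leRHS]mulrC ler_pdivlMr.
Qed.

End norms.

(** * Deterministic analysis of the conic program *)

Section conic.
Context {R : realType} {n p : nat}.
Variables (X W : 'M[R]_(n, p)) (xi : 'cV[R]_n) (sig2 : 'rV[R]_p)
  (thetas : 'cV[R]_p).

Let y := X *m thetas + xi.
Let Z := X + W.
Let G := W^T *m W.

(** The vector whose sup-norm is constrained by the conic program. *)
Definition residual (theta : 'cV[R]_p) : 'cV[R]_p :=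
  n%:R^-1 *: (Z^T *m (y - Z *m theta)) + diag_mx sig2 *m theta.

(** The last inequality compares Diag(W^T W) / n with the estimated variances
    directly, not through the true variances: the latter depend on the law of
    the noise, hence on the design, and leaving them out keeps the event
    visibly measurable in the pair (design, noise). *)
Definition noise_event (d1 d1' d2 d3 d4 d4' d5 : R) : Prop :=
  [/\ [/\ `|n%:R^-1 *: (X^T *m xi)| <= d2,
          `|n%:R^-1 *: (W^T *m xi)| <= d3,
          `|n%:R^-1 *: (X^T *m W)| <= d1 &
          `|n%:R^-1 *: (X^T *m W *m thetas)| <= d1' * lnorm 2%:E thetas],
      `|n%:R^-1 *: (G - Diag G)| <= d4,
      `|n%:R^-1 *: ((G - Diag G) *m thetas)| <= d4' * lnorm 2%:E thetas &
      `|n%:R^-1 *: Diag G - diag_mx sig2| <= d5].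

Let trZ : Z^T = X^T + W^T.
Proof. by rewrite /Z raddfD. Qed.

(** At the true parameter the signal cancels, as y - Z theta* = xi - W theta*.
    Of the remaining terms only Diag(W^T W) / n does not vanish as n grows, and
    it is compensated by the estimated variances. *)
Lemma residual_true : residual thetas =
  n%:R^-1 *: (X^T *m xi) + n%:R^-1 *: (W^T *m xi)
  - n%:R^-1 *: (X^T *m W *m thetas)
  - n%:R^-1 *: ((G - Diag G) *m thetas)
  - (n%:R^-1 *: Diag G - diag_mx sig2) *m thetas.
Proof.
rewrite /residual.
have -> : y - Z *m thetas = xi - W *m thetas.
  by rewrite /y /Z mulmxDl opprD addrACA subrr add0r.
rewrite trZ !mulmxBr !mulmxBl !mulmxDl -scalemxAl /G -!mulmxA.
move: (X^T *m xi) (X^T *m _) (W^T *m xi) (W^T *m _) (Diag _ *m _)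
  (diag_mx _ *m _) => a b c e f g.
by apply/matrixP => i j; rewrite !mxE; ring.
Qed.

(** The residual is affine in theta with linear part diag sig2 - Z^T Z / n;
    subtracting from that matrix its noise-free part isolates the Gram matrix. *)
Lemma residual_diff theta : gram X *m (theta - thetas) =
  residual thetas - residual theta
  - (n%:R^-1 *: (X^T *m W) + (n%:R^-1 *: (X^T *m W))^T
     + n%:R^-1 *: (G - Diag G) + (n%:R^-1 *: Diag G - diag_mx sig2))
    *m (theta - thetas).
Proof.
have -> : residual thetas - residual theta =
    (n%:R^-1 *: (Z^T *m Z) - diag_mx sig2) *m (theta - thetas).
  rewrite /residual !mulmxBr !mulmxBl -!scalemxAl -!mulmxA.
  move: (Z^T *m y) (Z^T *m _) (Z^T *m _) (diag_mx _ *m _) (diag_mx _ *m _).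
  move=> a b c e f.
  by apply/matrixP => i j; rewrite !mxE; ring.
rewrite -mulmxBl; congr (_ *m _).
rewrite /gram trZ /Z !mulmxDl !mulmxDr linearZ/= trmx_mul trmxK -/G.
move: (X^T *m X) (X^T *m W) (W^T *m X) G (Diag G) (diag_mx _).
move=> a b c e f g.
by apply/matrixP => i j; rewrite !mxE; ring.
Qed.

Variables (d1 d1' d2 d3 d4 d4' d5 : R).
Hypothesis noise : noise_event d1 d1' d2 d3 d4 d4' d5.

Let mu := d1' + d4' + d5.
Let tau := d2 + d3.

(** This is the reason for the choice of mu and tau. *)
Lemma residual_true_le : `|residual thetas| <= mu * lnorm 2%:E thetas + tau.
Proof.
case: noise => -[h2 h3 h1 h1'] h4 h4' h5.
have h5' : `|(n%:R^-1 *: Diag G - diag_mx sig2) *m thetas| <=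
    d5 * lnorm 2%:E thetas.
  have -> : n%:R^-1 *: Diag G - diag_mx sig2 =
      diag_mx (n%:R^-1 *: (\row_j G j j) - sig2).
    by rewrite /Diag linearB linearZ.
  apply: le_trans (mx_norm_diag_mulmx_le _ _) _.
  apply: ler_pM => //; last exact: mx_norm_le_lnorm2.
  apply: le_trans h5; by rewrite /Diag linearB linearZ.
rewrite residual_true.
apply: (@le_trans _ _ (d2 + d3 + d1' * lnorm 2%:E thetas
    + d4' * lnorm 2%:E thetas + d5 * lnorm 2%:E thetas)); last first.
  by rewrite /mu /tau; move: (lnorm 2%:E thetas) => L; lra.
apply: le_trans (ler_normB _ _) (lerD _ h5').
apply: le_trans (ler_normB _ _) (lerD _ h4').
apply: le_trans (ler_normB _ _) (lerD _ h1').
exact: le_trans (ler_normD _ _) (lerD h2 h3).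
Qed.

Variables (Theta : set 'cV[R]_p) (lambda : R) (thetahat : 'cV[R]_p) (that : R).
Hypotheses (lambda0 : 0 < lambda) (Theta_true : Theta thetas)
  (sol : conic_solution Theta y Z sig2 mu tau lambda thetahat that).

Let Delta := thetahat - thetas.
Let J := [set i | thetas i 0 != 0]%SET.

Lemma true_feasible :
  conic_feasible Theta y Z sig2 mu tau thetas (lnorm 2%:E thetas).
Proof. by split => //; [exact: lnorm_ge0|exact: residual_true_le]. Qed.

Lemma conic_solution_feasible :
  conic_feasible Theta y Z sig2 mu tau thetahat that.
Proof. by apply: (sol _).1; do 2 eexists; exact: true_feasible. Qed.

Lemma conic_solution_objective :
  lnorm 1%:E thetahat + lambda * that <=
  lnorm 1%:E thetas + lambda * lnorm 2%:E thetas.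
Proof.
have ex : exists theta t, conic_feasible Theta y Z sig2 mu tau theta t.
  by do 2 eexists; exact: true_feasible.
exact: (sol ex).2 true_feasible.
Qed.

(** Off its support the true parameter vanishes, so there the estimator equals
    the error; on the support the triangle inequality applies. *)
Lemma lnorm1_support_le : lnorm 1%:E thetas - lnorm 1%:E thetahat <=
  lnorm 1%:E (restrict J Delta) - lnorm 1%:E (restrict (~: J) Delta).
Proof.
rewrite (lnorm1_split J thetahat) !lnorm1_restrict.
have -> : lnorm 1%:E thetas = \sum_(i in J) `|thetas i 0|.
  rewrite lnorm1E [RHS]big_mkcond; apply: eq_bigr => i _.
  by rewrite inE; case: eqVneq => //= ->; rewrite normr0.
have -> : \sum_(i in ~: J) `|thetahat i 0| = \sum_(i in ~: J) `|Delta i 0|.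
  apply: eq_bigr => i; rewrite !inE negbK => /eqP ti.
  by rewrite !mxE ti subr0.
rewrite opprD addrA lerD2r lerBlDr -big_split/=; apply: ler_sum => i _.
rewrite !mxE distrC; have := ler_normD (thetas i 0 - thetahat i 0) (thetahat i 0).
by rewrite subrK.
Qed.

(** Restricted to its support, the true parameter is the estimator minus the
    error. *)
Lemma lnorm2_true_le :
  lnorm 2%:E thetas <= lnorm 2%:E thetahat + lnorm 1%:E (restrict J Delta).
Proof.
have tE : thetas = restrict J thetahat + restrict J (- Delta).
  apply/colP => i; rewrite !mxE inE.
  case: eqVneq => [->|_] /=; first by rewrite addr0.
  by rewrite opprB addrC subrK.
have -> : lnorm 1%:E (restrict J Delta) = lnorm 1%:E (restrict J (- Delta)).
  by rewrite !lnorm1_restrict; apply: eq_bigr => i _; rewrite [in RHS]mxE normrN.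
rewrite {1}tE; apply: le_trans (lnorm2D_le _ _) _; rewrite lerD2r.
rewrite !lnorm2E ler_wsqrtr//; apply: ler_sum => i _.
by rewrite mxE; case: ifP => // _; rewrite expr0n/= sqr_ge0.
Qed.

(** In a plain l_1 program optimality gives |Delta_{J^c}|_1 <= |Delta_J|_1.
    Here the objective also contains lambda t with t >= |thetahat|_2, and by
    [lnorm2_true_le] this costs at most lambda |Delta_J|_1 more. *)
Lemma conic_cone : cone J (1 + lambda) Delta.
Proof.
suff : lnorm 1%:E (restrict (~: J) Delta) <=
  (1 + lambda) * lnorm 1%:E (restrict J Delta) by [].
have [_ _ _ ht] := conic_solution_feasible.
have := conic_solution_objective; have := lnorm1_support_le.
have := lnorm2_true_le.
move: (lnorm 2%:E thetas) (lnorm 2%:E thetahat) ht (lnorm 1%:E thetas)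
  (lnorm 1%:E thetahat) (lnorm 1%:E (restrict J Delta))
  (lnorm 1%:E (restrict (~: J) Delta)) => a a' ht b b' e f h1 h2 h3.
have : lambda * a <= lambda * (that + e).
  by rewrite ler_pM2l// (le_trans h1)// lerD2r.
nra.
Qed.

(** Optimality read the other way: a large auxiliary variable has to be paid for
    by the l_1 part of the objective. *)
Lemma conic_t_le : that <= lnorm 2%:E thetas + lambda^-1 * lnorm 1%:E Delta.
Proof.
have := conic_solution_objective; have := lnorm1_support_le.
have := lnorm1_split J Delta.
have := lnorm_ge0 1%:E (restrict (~: J) Delta).
move: (lnorm 2%:E thetas) (lnorm 1%:E thetas) (lnorm 1%:E Delta)
  (lnorm 1%:E thetahat) (lnorm 1%:E (restrict J Delta))
  (lnorm 1%:E (restrict (~: J) Delta)) => a b D b' e f f0 DE h1 h2.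
rewrite -(ler_pM2l lambda0) mulrDr mulrA mulfV ?gt_eqF// mul1r.
lra.
Qed.

(** Both residuals are controlled, the true one by [residual_true_le] and the
    other by feasibility, where the auxiliary variable is traded for
    |theta*|_2 and |Delta|_1 by [conic_t_le]. *)
Lemma conic_gram_le : 0 <= mu ->
  `|gram X *m Delta| <= 2 * (mu * lnorm 2%:E thetas + tau)
    + (mu * lambda^-1 + 2 * d1 + d4 + d5) * lnorm 1%:E Delta.
Proof.
move=> mu0.
case: noise => -[_ _ h1 _] h4 _ h5.
have [_ _ hres _] := conic_solution_feasible.
have htrue := residual_true_le.
have ht := conic_t_le.
rewrite residual_diff.
set M := (X in X *m _).
have hM : `|M *m Delta| <= (2 * d1 + d4 + d5) * lnorm 1%:E Delta.
  apply: le_trans (mx_norm_mulmx_le _ _) _; rewrite ler_wpM2r ?lnorm_ge0//.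
  apply: le_trans (ler_normD _ _) (lerD _ h5).
  apply: le_trans (ler_normD _ _) (lerD _ h4).
  rewrite mulr_natl mulr2n; apply: le_trans (ler_normD _ _) (lerD h1 _).
  by rewrite mx_norm_trmx.
have hhat : `|residual thetahat| <=
    mu * (lnorm 2%:E thetas + lambda^-1 * lnorm 1%:E Delta) + tau.
  by apply: le_trans hres _; rewrite lerD2r ler_wpM2l.
apply: le_trans (ler_normB _ _) _.
apply: le_trans (lerD (ler_normB _ _) (lexx _)) _.
apply: le_trans (lerD (lerD htrue hhat) hM) _.
move: (lnorm 2%:E thetas) (lnorm 1%:E Delta) => L D.
by rewrite le_eqVlt; apply/orP; left; apply/eqP; ring.
Qed.

(** Duality between the sup-norm and the l_1 norm. *)
Lemma gram_quadratic :
  n%:R^-1 * lnorm 2%:E (X *m Delta) ^+ 2 <=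
  `|gram X *m Delta| * lnorm 1%:E Delta.
Proof.
rewrite lnorm2_sqr trmx_mul -mulmxA.
have -> : n%:R^-1 * (Delta^T *m (X^T *m (X *m Delta))) 0 0 =
    ((gram X *m Delta)^T *m Delta) 0 0.
  rewrite trmx_mul /gram linearZ/= trmx_mul trmxK -scalemxAr -scalemxAl [in RHS]mxE.
  by rewrite !mulmxA.
apply: le_trans (ler_norm _) _; apply: le_trans (norm_inner_le _ _) _.
by rewrite mx_norm_trmx.
Qed.

End conic.

Section error.
Context {R : realType} {n p : nat}.

Lemma nnzE (v : 'cV[R]_p) : nnz v = #|[set i | v i 0 != 0]%SET|.
Proof. by apply: eq_card => i; apply/idP/idP; rewrite !inE. Qed.

(** Since |Delta|_1 <= (2 + lambda) |Delta_J|_1 <= 4 |Delta_J|_1, the sensitivity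
    and Hoelder's inequality bound |Delta|_1 by (4 s / c) |Psi Delta|_oo.  The
    condition 8 A (s r) <= c makes the |Delta|_1 term of [conic_gram_le] at most
    half of |Psi Delta|_oo. *)
Lemma conic_error (X W : 'M[R]_(n, p)) (xi : 'cV[R]_n) (sig2 : 'rV[R]_p)
    (thetas thetahat : 'cV[R]_p) (that : R) (Theta : set 'cV[R]_p)
    (d1 d1' d2 d3 d4 d4' d5 lambda c A r : R) (q : \bar R) (s : nat) :
  noise_event X W xi sig2 thetas d1 d1' d2 d3 d4 d4' d5 ->
  conic_solution Theta (X *m thetas + xi) (X + W) sig2 (d1' + d4' + d5)
    (d2 + d3) lambda thetahat that ->
  Theta thetas -> (0 < s)%N -> (nnz thetas <= s)%N -> (1 <= q)%E ->
  2^-1 <= lambda <= 2 ->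
  0 < c -> 0 <= A -> 0 <= r ->
  ((c * s%:R `^ (- fine q^-1%E))%:E <= sensitivity q s (1 + lambda) (gram X))%E ->
  0 <= d1' + d4' + d5 <= A * r -> d2 + d3 <= A * r ->
  (d1' + d4' + d5) * lambda^-1 + 2 * d1 + d4 + d5 <= A * r ->
  8 * A * (s%:R * r) <= c ->
  lnorm q (thetahat - thetas) <=
    4 * A / c * s%:R `^ (fine q^-1%E) * r * (lnorm 2%:E thetas + 1) /\
  n%:R^-1 * lnorm 2%:E (X *m (thetahat - thetas)) ^+ 2 <=
    64 * A ^+ 2 / c * s%:R * r ^+ 2 * (lnorm 2%:E thetas + 1) ^+ 2.
Proof.
move=> noise sol Theta_true s_gt0 Js q1 /andP[lam1 lam2] c0 A0 r0 Hsens
  /andP[mu0 muA] tauA rhoA small.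
have lam0 : 0 < lambda by apply: lt_le_trans lam1; rewrite invr_gt0.
have Hcone := conic_cone noise lam0 Theta_true sol.
have Hgram := conic_gram_le noise lam0 Theta_true sol mu0.
have Hquad := gram_quadratic X thetas thetahat.
pose J := [set i | thetas i 0 != 0]%SET.
have HJ : (#|J| <= s)%N by rewrite -nnzE.
have Hkappa := sensitivity_le q1 Hsens HJ Hcone.
have Hhoelder := lnorm1_restrict_le (thetahat - thetas) q1 HJ.
have Hsplit := lnorm1_split J (thetahat - thetas).
have Hcone' : lnorm 1%:E (restrict (~: J) (thetahat - thetas)) <=
    (1 + lambda) * lnorm 1%:E (restrict J (thetahat - thetas)).
  exact: Hcone.
have := lnorm_ge0 1%:E (restrict J (thetahat - thetas)).
have := lnorm_ge0 1%:E (thetahat - thetas).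
have := lnorm_ge0 2%:E thetas.
have := lnorm_ge0 q (thetahat - thetas).
have := normr_ge0 (gram X *m (thetahat - thetas)).
move: Hgram Hquad Hkappa Hhoelder Hsplit Hcone'.
move: (lnorm 1%:E (restrict (~: _) _)) (lnorm 1%:E (restrict _ _))
  (lnorm 1%:E (thetahat - thetas)) (n%:R^-1 * lnorm 2%:E _ ^+ 2)
  (lnorm 2%:E thetas)
  (`|gram X *m (thetahat - thetas)|) (lnorm q (thetahat - thetas)).
move: (_ + 2 * d1 + d4 + d5) rhoA => rho rhoA.
move: (d1' + d4' + d5) mu0 muA (d2 + d3) tauA => mu mu0 muA tau tauA.
rewrite powRN; set k := s%:R `^ _.
move=> E F D Q L P N Hgram Hquad Hkappa Hhoelder Hsplit Hcone3 P0 N0 L0 D0 F0.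
have s0 : 0 <= s%:R :> R by [].
have k0 : 0 < k by rewrite powR_gt0// ltr0n.
have HN : N <= k * P / c.
  have := Hkappa; rewrite mulrAC ler_pdivrMr// => HN.
  by rewrite ler_pdivlMr// mulrC (le_trans HN)// mulrC.
have HF : F <= s%:R * P / c.
  rewrite -(ler_pM2r k0); apply: (le_trans Hhoelder).
  rewrite (_ : _ / c * k = s%:R * (k * P / c)); last by ring.
  by rewrite ler_wpM2l.
have HD : D <= 4 * (s%:R * P / c).
  rewrite Hsplit; apply: (@le_trans _ _ (4 * F)); last by rewrite ler_wpM2l.
  have : (1 + lambda) * F <= 3 * F by rewrite ler_wpM2r//; lra.
  by move: Hcone3; lra.
have Ar0 : 0 <= A * r by rewrite mulr_ge0.
have HP : P <= 4 * (A * r) * (L + 1).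
  (* absorption: this half is moved to the left-hand side *)
  have h1 : rho * D <= 2^-1 * P.
    apply: (@le_trans _ _ (A * r * (4 * (s%:R * P / c)))).
      by apply: le_trans (ler_wpM2r D0 rhoA) _; rewrite ler_wpM2l.
    rewrite (_ : _ * _ = 8 * A * (s%:R * r) * (P / c / 2)); last first.
      by field; rewrite gt_eqF.
    apply: (@le_trans _ _ (c * (P / c / 2))).
      by rewrite ler_wpM2r// !mulr_ge0 ?invr_ge0// ltW.
    by rewrite le_eqVlt; apply/orP; left; apply/eqP; field; rewrite gt_eqF.
  have h2 : mu * L <= A * r * L by rewrite ler_wpM2r.
  rewrite (_ : _ * (L + 1) = 4 * (A * r * L) + 4 * (A * r)); last by ring.
  move: Hgram h1 h2 tauA.
  move: (rho * D) (mu * L) (A * r * L) (A * r) => rD muL ArL Ar; lra.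
split.
  apply: (le_trans HN); rewrite ler_pdivrMr//.
  apply: (le_trans (ler_wpM2l (ltW k0) HP)).
  by rewrite le_eqVlt; apply/orP; left; apply/eqP; field; rewrite gt_eqF.
apply: (le_trans Hquad); apply: (le_trans (ler_wpM2l P0 HD)).
rewrite (_ : _ * _ = (4 * s%:R / c) * P ^+ 2); last by ring.
rewrite (_ : 64 * _ / c * _ * _ * _ =
  (4 * s%:R / c) * (4 * (A * r) * (L + 1)) ^+ 2); last by ring.
rewrite ler_wpM2l//; first by rewrite !mulr_ge0 ?invr_ge0// ltW.
by rewrite ler_pXn2r// nnegrE !mulr_ge0// addr_ge0.
Qed.

End error.

(** * Expectation of a product of independent factors *)

Section independence.
Import HBNNSimple.
Local Open Scope ereal_scope.
Context d d' (T : measurableType d) (T' : measurableType d') (R : realType).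
Variable P : {measure set T -> \bar R}.

Lemma integral_mul_nnsfun (Y : T -> T') (h : T -> R) (phi : {nnsfun T' >-> R}) :
  measurable_fun setT Y -> measurable_fun setT h -> (forall w, (0 <= h w)%R) ->
  \int[P]_w (h w * phi (Y w))%:E =
  \sum_(r \in range phi)
     r%:E * \int[P]_w (h w * \1_(phi @^-1` [set r]) (Y w))%:E.
Proof.
move=> mY mh h0.
have mI r : measurable_fun setT
    (fun w => (h w * \1_(phi @^-1` [set r]) (Y w))%:E).
  apply/measurable_EFinP; apply: measurable_funM => //.
  exact: (measurableT_comp (f := \1_(phi @^-1` [set r]) : T' -> R)).
transitivity (\sum_(r \in range phi)
     \int[P]_w (r%:E * (h w * \1_(phi @^-1` [set r]) (Y w))%:E)).
  rewrite -ge0_integral_fsum//.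
  - apply: eq_integral => w _; rewrite fimfunE EFinM -fsumEFin// ge0_mule_fsumr.
      by apply: eq_fsbigr => r _; rewrite !EFinM muleCA.
    by move=> r; exact: nnfun_muleindic_ge0.
  - by move=> r; exact: measurable_funeM.
  - move=> r w _; rewrite EFinM muleCA; apply: mule_ge0; first by rewrite lee_fin.
    exact: nnfun_muleindic_ge0.
apply: eq_fsbigr => r /[!inE] -[y _ <-].
by rewrite ge0_integralZl// ?lee_fin// => w _; rewrite lee_fin mulr_ge0.
Qed.

(** A factor that decouples from every indicator of Y decouples from every
    nonnegative measurable function of Y, by approximation from below with
    simple functions.  Finiteness of C lets multiplication by C commute with the
    limit. *)
Lemma integral_mul_comp (Y : T -> T') (h : T -> R) (C : \bar R)
    (g : T' -> R) :
  measurable_fun setT Y -> measurable_fun setT h -> (forall w, (0 <= h w)%R) ->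
  0 <= C -> C \is a fin_num ->
  measurable_fun setT g -> (forall y, (0 <= g y)%R) ->
  (forall B, measurable B -> \int[P]_w (h w * \1_B (Y w))%:E =
      C * \int[P]_w (\1_B (Y w))%:E) ->
  \int[P]_w (h w * g (Y w))%:E = C * \int[P]_w (g (Y w))%:E.
Proof.
move=> mY mh h0 C0 Cfin mg g0 hB.
have mg' : measurable_fun setT (EFin \o g) by exact/measurable_EFinP.
pose phi := nnsfun_approx measurableT mg'.
have phiE n : \int[P]_w (h w * phi n (Y w))%:E =
    C * \int[P]_w (phi n (Y w))%:E.
  have : \int[P]_w (phi n (Y w))%:E = \sum_(r \in range (phi n))
      r%:E * \int[P]_w (\1_(phi n @^-1` [set r]) (Y w))%:E.
    have := @integral_mul_nnsfun Y (cst 1%R) (phi n) mY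
      (measurable_cst _) (fun=> ler01).
    under eq_integral do rewrite mul1r.
    move=> ->; apply: eq_fsbigr => r _; congr (_ * _).
    by apply: eq_integral => w _; rewrite mul1r.
  move=> ->; rewrite integral_mul_nnsfun//.
  rewrite ge0_mule_fsumr; last first.
    move=> r; have [r0|r0] := leP 0%R r.
      by apply: mule_ge0 => //; apply: integral_ge0 => w _; rewrite lee_fin.
    rewrite integral0_eq ?mule0// => w _.
    by rewrite preimage_nnfun0// indicE in_set0.
  by apply: eq_fsbigr => r _; rewrite hB// muleCA.
have mphi n : measurable_fun setT (fun w => (phi n (Y w))%:E).
  by apply/measurable_EFinP; exact: measurableT_comp.
have nd y m n : (m <= n)%N -> (phi m y <= phi n y)%R.
  by move=> mn; exact/lefP/nd_nnsfun_approx.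
have cphi w : (phi n (Y w))%:E @[n --> \oo] --> (g (Y w))%:E.
  apply: (@cvg_nnsfun_approx _ _ _ _ measurableT _ mg') => // y _.
  by rewrite /= lee_fin.
have c1 : \int[P]_w (h w * phi n (Y w))%:E @[n --> \oo]
    --> \int[P]_w (h w * g (Y w))%:E.
  have -> : \int[P]_w (h w * g (Y w))%:E =
      \int[P]_w (limn (fun n => (h w * phi n (Y w))%:E)).
    apply: eq_integral => w _; apply/esym/cvg_lim => //.
    under eq_fun do rewrite EFinM.
    by rewrite EFinM; apply: cvgeZl.
  apply: cvg_monotone_convergence => //.
  - by move=> n; under eq_fun do rewrite EFinM; apply: emeasurable_funM => //;
      exact/measurable_EFinP.
  - by move=> n w _; rewrite lee_fin mulr_ge0.
  - by move=> w _ m n mn; rewrite lee_fin ler_wpM2l// nd.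
have c2 : \int[P]_w (phi n (Y w))%:E @[n --> \oo] --> \int[P]_w (g (Y w))%:E.
  have -> : \int[P]_w (g (Y w))%:E =
      \int[P]_w (limn (fun n => (phi n (Y w))%:E)).
    by apply: eq_integral => w _; apply/esym/cvg_lim.
  apply: cvg_monotone_convergence => //.
  - by move=> n w _; rewrite lee_fin.
  - by move=> w _ m n mn; rewrite lee_fin nd.
move/cvg_lim : c1 => <- //; apply/cvg_lim => //.
under eq_fun do rewrite phiE.
exact: cvgeZl.
Qed.
End independence.

(** When every factor is an indicator this is the definition of mutual
    independence.  Factors are then freed one at a time with
    [integral_mul_comp]: the induction is over the list of those that need not
    be indicators. *)
Lemma mutually_independent_integral_prod d d' (T : measurableType d)
    (T' : measurableType d') (R : realType) (P : probability T R)
    (I : finType) (Y : I -> T -> T') (g : I -> T' -> R) :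
  mutually_independent P Y -> (forall i, measurable_fun setT (Y i)) ->
  (forall i, measurable_fun setT (g i)) -> (forall i y, 0 <= g i y) ->
  (forall i, \int[P]_w (g i (Y i w))%:E < +oo)%E ->
  (\int[P]_w (\prod_i g i (Y i w))%:E = \prod_i \int[P]_w (g i (Y i w))%:E)%E.
Proof.
move=> indep mY mg g0 gfin.
have mpre i B : measurable B -> measurable (Y i @^-1` B).
  by move=> mB; rewrite -[X in measurable X]setTI; apply: mY.
have : forall i, i \notin enum I ->
    exists2 A, measurable A & g i = (\1_A : T' -> R).
  by move=> i; rewrite mem_enum.
elim: (enum I) g mg g0 gfin => [|k s IH] g mg g0 gfin gI.
  have /choice[A mA] : forall i, exists A, measurable A /\ g i = (\1_A : T' -> R).
    by move=> i; have [//|A] := gI i; exists A.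
  have intY i : (\int[P]_w (g i (Y i w))%:E = P (Y i @^-1` A i))%E.
    rewrite (mA i).2 -[X in P X]setIT -integral_indic//.
    by apply: mpre; exact: (mA i).1.
  rewrite (eq_bigr _ (fun i _ => intY i)).
  transitivity (\prod_(i in [set: I]%SET) P (Y i @^-1` A i))%E; last first.
    by apply: eq_bigl => i; rewrite inE.
  rewrite -indep; last by move=> i; exact: (mA i).1.
  rewrite -[X in P X]setIT -integral_indic//; last first.
    apply: fin_bigcap_measurable => // i _.
    by apply: mpre; exact: (mA i).1.
  apply: eq_integral => w _; congr EFin.
  rewrite indicE; have [wA|wA] := boolP (w \in _).
    rewrite big1// => i _; rewrite (mA i).2 indicE mem_set//.
    by move: wA; rewrite inE => /(_ i); apply; rewrite /= inE.
  apply/eqP; rewrite prodf_seq_eq0; apply: contraNT wA => /hasPn h.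
  rewrite inE => i _ /=; have := h i; rewrite mem_index_enum => /(_ isT) /=.
  rewrite (mA i).2 indicE; case: (boolP (_ \in _)); first by rewrite inE.
  by rewrite eqxx.
have [ks|ks] := boolP (k \in s).
  apply: IH => // i si; apply: gI; rewrite inE negb_or si andbT.
  by apply: contraNneq si => ->.
have finI i : (\int[P]_w (g i (Y i w))%:E)%E \is a fin_num.
  by rewrite ge0_fin_numE//; apply: integral_ge0 => w _; rewrite lee_fin.
have mgY i : measurable_fun setT (fun w => g i (Y i w)).
  exact: measurableT_comp.
rewrite (bigD1 k)//=.
under eq_integral do rewrite (bigD1 k)//= mulrC.
rewrite muleC; apply: integral_mul_comp => //.
- under eq_fun do rewrite -big_filter.
  exact: measurable_prod.
- by move=> w; apply: prodr_ge0.
- apply: prode_ge0 => i _; apply: integral_ge0 => w _; rewrite lee_fin//.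
- by apply: prode_fin_num => i _; exact: finI.
move=> B mB.
pose g' i := if i == k then (\1_B : T' -> R) else g i.
have g'k : g' k = \1_B by rewrite /g' eqxx.
have g'E i : i != k -> g' i = g i by rewrite /g' => /negbTE ->.
have H : (\int[P]_w (\prod_i g' i (Y i w))%:E =
    \prod_i \int[P]_w (g' i (Y i w))%:E)%E.
  apply: IH.
  - by move=> i; rewrite /g'; case: ifP.
  - by move=> i y; rewrite /g'; case: ifP.
  - move=> i; have [->|/g'E ->//] := eqVneq i k; rewrite g'k.
    have -> : (fun w => (\1_B (Y k w))%:E) = EFin \o (\1_(Y k @^-1` B) : T -> R).
      by [].
    rewrite integral_indic//; last exact: mpre.
    by rewrite setIT ltey_eq fin_num_measure//; exact: mpre.
  - move=> i si; have [->|ik] := eqVneq i k; first by exists B.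
    by rewrite g'E//; apply: gI; rewrite inE negb_or ik.
rewrite (bigD1 k)//= g'k in H.
rewrite muleC (eq_bigr (fun i => (\int[P]_w (g' i (Y i w))%:E)%E)); last first.
  by move=> i /g'E ->.
rewrite -H; apply: eq_integral => w _.
rewrite [in RHS](bigD1 k)//= g'k mulrC; congr (_ * _)%:E.
by apply: eq_bigr => i /g'E ->.
Qed.

(** * Subgaussian tails *)

(** [subgaussian P gamma] is by conversion [variance_proxy P (gamma ^+ 2)].
    Indexing by the variance makes sums of independent variables additive. *)
Definition variance_proxy {d} {T : measurableType d} {R : realType}
    (P : probability T R) (v : R) (eta : T -> R) : Prop :=
  forall t : R,
    ('E_P[fun w => expR (t * eta w)] <= (expR (v * t ^+ 2 / 2))%:E)%E.

Section variance_proxy.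
Context d (T : measurableType d) (R : realType) (P : probability T R).
Implicit Types (v : R) (eta : T -> R).

Lemma variance_proxyZ v eta a : variance_proxy P v eta ->
  variance_proxy P (a ^+ 2 * v) (fun w => a * eta w).
Proof.
move=> Hv t.
under eq_fun do rewrite mulrA.
by rewrite (_ : _ * _ / 2 = v * (t * a) ^+ 2 / 2); [exact: Hv|ring].
Qed.

Lemma le_variance_proxy v v' eta : v <= v' -> variance_proxy P v eta ->
  variance_proxy P v' eta.
Proof.
move=> vv' Hv t; apply: (le_trans (Hv t)).
by rewrite lee_fin ler_expR ler_wpM2r ?invr_ge0// ler_wpM2r// sqr_ge0.
Qed.

(** Moment generating functions of independent variables multiply, so the
    proxies in their exponents add. *)
Lemma variance_proxy_sum d' (T' : measurableType d') (I : finType)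
    (Y : I -> T -> T') (f : I -> T' -> R) (v : I -> R) :
  mutually_independent P Y -> (forall i, measurable_fun setT (Y i)) ->
  (forall i, measurable_fun setT (f i)) ->
  (forall i, variance_proxy P (v i) (fun w => f i (Y i w))) ->
  variance_proxy P (\sum_i v i) (fun w => \sum_i f i (Y i w)).
Proof.
move=> indep mY mf Hv t.
have Hv' i : (\int[P]_w (expR (t * f i (Y i w)))%:E <=
    (expR (v i * t ^+ 2 / 2))%:E)%E by have := Hv i t; rewrite unlock.
rewrite unlock.
under eq_integral do rewrite mulr_sumr expR_sum.
rewrite (@mutually_independent_integral_prod _ _ _ _ _ _ _ Y
  (fun i y => expR (t * f i y)))//.
- rewrite !mulr_suml expR_sum -prodEFin.
  have int0 i : (0 <= \int[P]_w (expR (t * f i (Y i w)))%:E)%E.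
    by apply: integral_ge0 => w _; rewrite lee_fin expR_ge0.
  elim: (index_enum I) => [|i s IH]; rewrite ?big_nil// !big_cons.
  by apply: lee_pmul => //; exact: prode_ge0.
- move=> i; apply: measurableT_comp => //; exact: measurable_funM.
- move=> i; exact: le_lt_trans (Hv' i) (ltry _).
Qed.

Lemma variance_proxy_chernoff v eta (t a : R) : measurable_fun setT eta -> 0 < t ->
  variance_proxy P v eta ->
  (P [set w | (a <= eta w)%R] <= (expR (v * t ^+ 2 / 2 - t * a))%:E)%E.
Proof.
move=> meta t0 Hv.
pose mf := @isMeasurableFun.Build _ _ _ _ _ meta.
pose X : {RV P >-> R} := HB.pack_for {mfun T >-> R} eta mf.
apply: (le_trans (chernoff X a t0)).
rewrite expRD EFinM lee_pmul2r ?lte_fin ?expR_gt0//.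
have := Hv t; rewrite /mmt_gen_fun.
by under eq_fun do rewrite mulrC.
Qed.

(** Chernoff's bound at its optimal parameter a / v.  A vanishing proxy is
    included because noise of zero level is allowed: the threshold is then 0, and
    no single parameter suffices. *)
Lemma variance_proxy_tail v eta L : measurable_fun setT eta -> 0 <= v ->
  0 <= L -> variance_proxy P v eta ->
  (P [set w | (Num.sqrt (2 * v * L) < eta w)%R] <= (expR (- L))%:E)%E.
Proof.
move=> meta v0 L0 Hv.
have mle a : measurable [set w | a <= eta w].
  rewrite -[X in measurable X]setTI -[[set w | _]]/(eta @^-1` [set x | a <= x]).
  by rewrite -set_itvcy; apply: meta.
have mlt a : measurable [set w | a < eta w].
  rewrite -[X in measurable X]setTI -[[set w | _]]/(eta @^-1` [set x | a < x]).
  by rewrite -set_itvoy; apply: meta.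
move: L0; rewrite le_eqVlt => /predU1P[<-|L0].
  by rewrite oppr0 expR0 probability_le1.
move: v0; rewrite le_eqVlt => /predU1P[vE|v0]; last first.
  set a := Num.sqrt _.
  have a0 : 0 < a by rewrite sqrtr_gt0 !mulr_gt0.
  have a2 : a ^+ 2 = 2 * v * L by rewrite sqr_sqrtr// !mulr_ge0// ltW.
  apply: (@le_trans _ _ (P [set w | a <= eta w])).
    by apply: le_measure; rewrite ?inE// => w /= /ltW.
  apply: (le_trans (variance_proxy_chernoff a meta (divr_gt0 a0 v0) Hv)).
  rewrite lee_fin ler_expR expr_div_n [_ / v * a]mulrAC -expr2 a2.
  rewrite le_eqVlt; apply/orP; left; apply/eqP.
  by field; rewrite gt_eqF.
(* The parameter can be sent to infinity at each level 1 / (k + 1), so eta is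
   almost surely nonpositive. *)
rewrite -vE mulr0 mul0r sqrtr0.
suff -> : P [set w | 0 < eta w] = 0%E by rewrite lee_fin expR_ge0.
have P0 k : P [set w | k.+1%:R^-1 <= eta w] = 0%E.
  apply/eqP; rewrite eq_le measure_ge0 andbT.
  apply/lee_addgt0Pr => e e0; rewrite add0e.
  (* At this t the bound is exp (- 1 / e), which is at most e. *)
  pose t := k.+1%:R * (e^-1).
  have t0 : 0 < t by rewrite mulr_gt0 ?invr_gt0.
  apply: (le_trans (variance_proxy_chernoff _ meta t0 Hv)).
  rewrite -vE !mul0r sub0r lee_fin /t mulrAC mulfV// mul1r expRN.
  rewrite -[leRHS]invrK lef_pV2 ?posrE ?expR_gt0 ?invr_gt0//.
  by apply: le_trans (expR_ge1Dx _); rewrite lerDr.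
have : P.-negligible [set w | 0 < eta w].
  apply: (@negligibleS _ _ _ _ (\bigcup_k [set w | k.+1%:R^-1 <= eta w])).
    move=> w /= w0; exists (Num.truncn (eta w)^-1) => //=.
    rewrite -[leRHS]invrK lef_pV2 ?posrE ?invr_gt0//.
    by rewrite ltW// truncnS_gt.
  by apply: negligible_bigcup => k; apply/negligibleP => //; exact: P0.
by move/negligibleP; apply.
Qed.

End variance_proxy.

(** * Probability lower bounds *)

Section prob_ge.
Context d (T : measurableType d) (R : realType) (P : probability T R).

Lemma prob_geS (A B : set T) a : A `<=` B -> prob_ge P A a -> prob_ge P B a.
Proof.
by move=> AB [C [mC CA PC]]; exists C; split => //; apply: subset_trans AB.
Qed.

Lemma prob_geC (A : set T) a : measurable A -> (P (~` A) <= a%:E)%E ->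
  prob_ge P A (1 - a).
Proof.
move=> mA PA; exists A; split => //.
rewrite (_ : P A = 1 - P (~` A))%E; first by rewrite EFinB leeB.
by rewrite -probability_setC ?setCK//; exact: measurableC.
Qed.

(** Union bound for the complements of the measurable sets inside A and B. *)
Lemma prob_geI (A B : set T) a b : prob_ge P A (1 - a) -> prob_ge P B (1 - b) ->
  prob_ge P (A `&` B) (1 - (a + b)).
Proof.
move=> [A' [mA AA PA]] [B' [mB BB PB]].
have PC (D : set T) e : measurable D -> ((1 - e)%:E <= P D)%E ->
    (P (~` D) <= e%:E)%E.
  move=> mD PD; rewrite probability_setC// leeBlDr; last exact: fin_num_measure.
  by rewrite addeC -leeBlDr// -EFinB.
apply: (@prob_geS (A' `&` B')); first exact: setISS.
apply: prob_geC; first exact: measurableI.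
rewrite setCI; apply: (le_trans (measureU2 _ _ _)); try exact: measurableC.
by rewrite EFinD; apply: leeD; exact: PC.
Qed.

Lemma prob_ge_forall (I : finType) (A : I -> set T) (a : I -> R) :
  (forall i, prob_ge P (A i) (1 - a i)) ->
  prob_ge P [set w | forall i, A i w] (1 - \sum_i a i).
Proof.
move=> PA.
suff H : forall s : seq I, prob_ge P [set w | forall i, i \in s -> A i w]
    (1 - \sum_(i <- s) a i).
  apply: prob_geS (H (index_enum I)) => w /= Hw i; apply: Hw.
  exact: mem_index_enum.
elim=> [|i s IH].
  rewrite big_nil subr0; exists setT; split => //; by rewrite probability_setT.
rewrite big_cons; apply: prob_geS (prob_geI (PA i) IH) => w /= [Ai As] j.
by rewrite inE => /predU1P[->//|]; exact: As.
Qed.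

End prob_ge.

(** * Measurability of matrix-valued maps *)

Section measurable_matrix_valued.
Context d (T : measurableType d) (R : realType).

Lemma measurable_coord m n i j :
  measurable_fun setT (fun A : 'M[R]_(m, n) => A i j).
Proof.
move=> _ B mB; apply: sub_sigma_algebra.
by exists (i, j) => //=; exists B.
Qed.

Lemma measurable_mxP m n (F : T -> 'M[R]_(m, n)) :
  measurable_fun setT F <->
  forall i j, measurable_fun setT (fun w => F w i j).
Proof.
split=> [mF i j|mF].
  exact: (measurableT_comp (measurable_coord i j)).
apply: (measurability (\bigcup_(ij in [set: 'I_m * 'I_n])
        preimage_set_system setT (fun A : 'M[R]_(m, n) => A ij.1 ij.2)
          measurable)) => //.
move=> _ [_ [[i j] _ [B mB <-]] <-].
by rewrite !setTI; have := mF i j measurableT B mB; rewrite setTI.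
Qed.

Lemma measurable_mxD m n (F G : T -> 'M[R]_(m, n)) :
  measurable_fun setT F -> measurable_fun setT G ->
  measurable_fun setT (fun w => F w + G w).
Proof.
move=> /measurable_mxP mF /measurable_mxP mG; apply/measurable_mxP => i j.
by under eq_fun do rewrite mxE; exact: measurable_funD.
Qed.

Lemma measurable_mxN m n (F : T -> 'M[R]_(m, n)) :
  measurable_fun setT F -> measurable_fun setT (fun w => - F w).
Proof.
move=> /measurable_mxP mF; apply/measurable_mxP => i j.
by under eq_fun do rewrite mxE; exact: measurableT_comp.
Qed.

Lemma measurable_mxM m n p (F : T -> 'M[R]_(m, n)) (G : T -> 'M[R]_(n, p)) :
  measurable_fun setT F -> measurable_fun setT G ->
  measurable_fun setT (fun w => F w *m G w).
Proof.
move=> /measurable_mxP mF /measurable_mxP mG; apply/measurable_mxP => i j.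
under eq_fun do rewrite mxE.
by apply: measurable_sum => k; exact: measurable_funM.
Qed.

Lemma measurable_mxZ m n (a : R) (F : T -> 'M[R]_(m, n)) :
  measurable_fun setT F -> measurable_fun setT (fun w => a *: F w).
Proof.
move=> /measurable_mxP mF; apply/measurable_mxP => i j.
by under eq_fun do rewrite mxE; exact: measurable_funM.
Qed.

Lemma measurable_trmx m n (F : T -> 'M[R]_(m, n)) :
  measurable_fun setT F -> measurable_fun setT (fun w => (F w)^T).
Proof.
move=> /measurable_mxP mF; apply/measurable_mxP => i j.
by under eq_fun do rewrite mxE; exact: mF.
Qed.

Lemma measurable_row m n i (F : T -> 'M[R]_(m, n)) :
  measurable_fun setT F -> measurable_fun setT (fun w => row i (F w)).
Proof.
move=> /measurable_mxP mF; apply/measurable_mxP => k j.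
by under eq_fun do rewrite mxE; exact: mF.
Qed.

Lemma measurable_diag_mx n (F : T -> 'rV[R]_n) :
  measurable_fun setT F -> measurable_fun setT (fun w => diag_mx (F w)).
Proof.
move=> /measurable_mxP mF; apply/measurable_mxP => i j.
under eq_fun do rewrite mxE.
by case: (i == j); [exact: mF|exact: measurable_cst].
Qed.

Lemma measurable_Diag n (F : T -> 'M[R]_n) :
  measurable_fun setT F -> measurable_fun setT (fun w => Diag (F w)).
Proof.
move=> /measurable_mxP mF; apply: measurable_diag_mx.
by apply/measurable_mxP => i j; under eq_fun do rewrite mxE; exact: mF.
Qed.

Lemma measurable_mx_norm m n (F : T -> 'M[R]_(m, n)) :
  measurable_fun setT F -> measurable_fun setT (fun w => `|F w|).
Proof.
move=> /measurable_mxP mF.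
rewrite (_ : (fun w => _) =
    (fun w => \big[Num.max/0]_ij `|F w ij.1 ij.2|)); last first.
  by apply/funext => w; rewrite -mx_normrE.
elim: (index_enum _) => [|ij s IH].
  by under eq_fun do rewrite big_nil; exact: measurable_cst.
under eq_fun do rewrite big_cons.
by apply: measurable_maxr => //; exact: measurableT_comp.
Qed.

Lemma measurable_mx_norm_le m n (F : T -> 'M[R]_(m, n)) (r : R) :
  measurable_fun setT F -> measurable [set w | `|F w| <= r].
Proof.
move=> /measurable_mx_norm mF; rewrite -[X in measurable X]setTI.
rewrite -[[set w | _]]/((fun w => `|F w|) @^-1` [set x | x <= r]).
by rewrite -set_itvNyc; exact: mF.
Qed.

End measurable_matrix_valued.

Lemma measurable_and4 d (T : measurableType d) (A B C D : set T) :
  measurable A -> measurable B -> measurable C -> measurable D ->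
  measurable [set w | [/\ A w, B w, C w & D w]].
Proof.
move=> mA mB mC mD.
rewrite (_ : [set w | _] = A `&` B `&` (C `&` D)); last first.
  by apply/seteqP; split => [w []|w [[? ?] []]].
by apply: measurableI; exact: measurableI.
Qed.

(** Joint measurability is what allows the event to be disintegrated. *)
Lemma measurable_noise_event {R : realType} (n p : nat) (thetas : 'cV[R]_p)
    (d1 d1' d2 d3 d4 d4' d5 : R) :
  measurable [set xe : 'M[R]_(n, p) * ('cV[R]_n * 'M[R]_(n, p) * 'rV[R]_p) |
    noise_event xe.1 xe.2.1.2 xe.2.1.1 xe.2.2 thetas d1 d1' d2 d3 d4 d4' d5].
Proof.
pose S := ('M[R]_(n, p) * ('cV[R]_n * 'M[R]_(n, p) * 'rV[R]_p))%type.
have mX : measurable_fun setT (fun xe : S => xe.1) by exact: measurable_fst.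
have me : measurable_fun setT (fun xe : S => xe.2) by exact: measurable_snd.
have msig : measurable_fun setT (fun xe : S => xe.2.2).
  exact: (measurableT_comp measurable_snd me).
have mn : measurable_fun setT (fun xe : S => xe.2.1).
  exact: (measurableT_comp measurable_fst me).
have mW : measurable_fun setT (fun xe : S => xe.2.1.2).
  exact: (measurableT_comp measurable_snd mn).
have mxi : measurable_fun setT (fun xe : S => xe.2.1.1).
  exact: (measurableT_comp measurable_fst mn).
have mXT := measurable_trmx mX; have mWT := measurable_trmx mW.
have mG := measurable_mxM mWT mW.
have mDiag := measurable_Diag mG.
have moff := measurable_mxD mG (measurable_mxN mDiag).
have mth : measurable_fun setT (fun _ : S => thetas) by exact: measurable_cst.
have mXW := measurable_mxM mXT mW.
apply: measurable_and4; first apply: measurable_and4;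
  apply: measurable_mx_norm_le.
- exact/measurable_mxZ/measurable_mxM.
- exact/measurable_mxZ/measurable_mxM.
- exact/measurable_mxZ.
- exact/measurable_mxZ/measurable_mxM.
- exact/measurable_mxZ.
- exact/measurable_mxZ/measurable_mxM.
- apply: measurable_mxD; first exact: measurable_mxZ.
  exact/measurable_mxN/measurable_diag_mx.
Qed.

(** * Probability of the noise event for a fixed design *)

Section tails.
Context d (T : measurableType d) (R : realType) (P : probability T R).

(** Union bound over the 2 m k one-sided deviations of the entries; the
    logarithm makes each of them of probability eps / (2 m k). *)
Lemma mx_norm_tail m k (A : T -> 'M[R]_(m, k)) (v eps : R) :
  measurable_fun setT A -> 0 <= v -> 0 < eps < 1 ->
  (forall i j, variance_proxy P v (fun w => A w i j)) ->
  prob_ge P [set w | `|A w| <= Num.sqrt (2 * v * ln (2 * (m * k)%:R / eps))]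
    (1 - eps).
Proof.
move=> mA v0 /andP[eps0 eps1] Av; set a := Num.sqrt _.
have [mk0|mk0] := posnP (m * k)%N.
  exists setT; split => //; last by rewrite probability_setT lee_fin gerBl ltW.
  move=> w _; apply/mx_norm_leP => [|i j]; first exact: sqrtr_ge0.
  suff : (0 < m * k)%N by rewrite mk0.
  by rewrite muln_gt0 (leq_ltn_trans _ (ltn_ord i))// (leq_ltn_trans _ (ltn_ord j)).
have mk0' : 0 < (m * k)%:R :> R by rewrite ltr0n.
have arg0 : 0 < 2 * (m * k)%:R / eps by rewrite divr_gt0// mulr_gt0.
have L0 : 0 <= ln (2 * (m * k)%:R / eps).
  apply: ln_ge0; rewrite ler_pdivlMr// mul1r (le_trans (ltW eps1))//.
  by rewrite mulr_natl mulr2n -natrD ler1n addn_gt0 mk0.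
pose e := eps / (m * k)%:R.
have entry (ij : 'I_m * 'I_k) :
    prob_ge P [set w | `|A w ij.1 ij.2| <= a] (1 - e).
  case: ij => i j /=.
  have mAij := (measurable_mxP A).1 mA i j.
  have mN : measurable_fun setT (fun w => (-1) * A w i j).
    exact: measurable_funM.
  have AvN : variance_proxy P v (fun w => (-1) * A w i j).
    have := variance_proxyZ (-1) (Av i j).
    by rewrite sqrrN expr1n mul1r.
  have half : expR (- ln (2 * (m * k)%:R / eps)) = e / 2.
    rewrite expRN lnK ?posrE// /e.
    move: ((m * k)%:R : R) mk0' => M M0; field.
    by rewrite !gt_eqF.
  have meas_le (f : T -> R) : measurable_fun setT f ->
      measurable [set w | f w <= a].
    move=> mf; rewrite -[X in measurable X]setTI.
    rewrite -[[set w | _]]/(f @^-1` [set x | x <= a]).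
    by rewrite -set_itvNyc; exact: mf.
  have up : prob_ge P [set w | A w i j <= a] (1 - e / 2).
    apply: prob_geC; first exact: meas_le.
    rewrite -half; apply: le_trans (variance_proxy_tail mAij v0 L0 (Av i j)).
    rewrite (_ : ~` _ = [set w | a < A w i j])//.
    by apply/seteqP; split => w /=; rewrite real_ltNge ?num_real// => /negP.
  have lo : prob_ge P [set w | (-1) * A w i j <= a] (1 - e / 2).
    apply: prob_geC; first exact: (meas_le (fun w => (-1) * A w i j)).
    rewrite -half; apply: le_trans (variance_proxy_tail mN v0 L0 AvN).
    rewrite (_ : ~` _ = [set w | a < (-1) * A w i j])//.
    by apply/seteqP; split => w /=; rewrite real_ltNge ?num_real// => /negP.
  have := prob_geI up lo; rewrite -splitr; apply: prob_geS => w /= [h1 h2].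
  by rewrite ler_norml h1 andbT lerNl -mulN1r.
have := prob_ge_forall entry; rewrite sumr_const card_prod !card_ord.
rewrite -mulr_natr /e divfK ?gt_eqF//.
apply: prob_geS => w /= Aw; apply/mx_norm_leP => [|i j]; first exact: sqrtr_ge0.
exact: (Aw (i, j)).
Qed.

Lemma response_noise_sum sigma n (xi : T -> 'cV[R]_n) (a : 'I_n -> R) :
  measurable_fun setT xi -> response_noise P sigma xi ->
  variance_proxy P ((\sum_i a i ^+ 2) * sigma ^+ 2)
    (fun w => \sum_i a i * xi w i 0).
Proof.
move=> mxi [indep _ sub]; rewrite mulr_suml.
apply: (variance_proxy_sum (Y := fun i w => xi w i 0)
  (f := fun i y => a i * y)) => //.
- by move=> i; exact: (measurable_mxP xi).1.
- by move=> i; exact: measurable_funM.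
- move=> i; apply: variance_proxyZ; exact: sub.
Qed.

(** Subgaussianity of the rows is assumed along unit vectors only, so theta is
    normalized; the zero vector is a separate case. *)
Lemma design_noise_sum sigmaW n p (xi : T -> 'cV[R]_n) (W : T -> 'M[R]_(n, p))
    (a : 'I_n -> R) (theta : 'cV[R]_p) :
  measurable_fun setT W -> design_noise P sigmaW xi W ->
  variance_proxy P
    ((\sum_i a i ^+ 2) * (sigmaW ^+ 2 * lnorm 2%:E theta ^+ 2))
    (fun w => \sum_i a i * (row i (W w) *m theta) 0 0).
Proof.
move=> mW [indep _ sub _ _]; rewrite mulr_suml.
apply: (variance_proxy_sum (Y := fun i w => row i (W w))
  (f := fun i y => a i * (y *m theta) 0 0)) => //.
- by move=> i; exact: measurable_row.
- move=> i; apply: measurable_funM => //.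
  have /measurable_mxP := measurable_mxM (@measurable_id _ 'rV[R]_p setT)
    (@measurable_cst _ _ _ _ setT theta).
  exact.
- move=> i; apply: variance_proxyZ.
  have two : (1 <= 2%:E :> \bar R)%E by rewrite lee_fin ler1n.
  have [t0|t0] := eqVneq (lnorm 2%:E theta) 0.
    rewrite t0 (lnorm_eq0 two t0) => t.
    under eq_fun do rewrite mulmx0 mxE mulr0.
    by rewrite expectation_cst lee_fin expr0n/= mulr0 !mul0r.
  rewrite mulrC.
  have := variance_proxyZ (lnorm 2%:E theta)
    (sub i ((lnorm 2%:E theta)^-1 *: theta) _).
  rewrite lnormZ// gtr0_norm ?invr_gt0 ?lt_neqAle ?lnorm_ge0 1?eq_sym ?t0//.
  rewrite mulVf// => /(_ erefl).
  under eq_fun do rewrite -scalemxAr mxE mulrA mulfV// mul1r.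
  exact.
Qed.

End tails.

(** The level of the maximum of |X^T W / n| over its p^2 entries.  While the
    tuning parameters see X^T W only through its action on theta*, the analysis
    of the error needs its action on the data-dependent vector Delta. *)
Definition delta1 {R : realType} (sigmaW m2 : R) (n p : nat) (eps : R) : R :=
  sigmaW * Num.sqrt (2 * m2 * ln (2 * (p * p)%:R / eps) / n%:R).

Section design_tails.
Context d (T : measurableType d) (R : realType) (P : probability T R).
Variables (n p : nat) (X : 'M[R]_(n, p)) (m2 : R).
Hypothesis (Xm2 : forall j, n%:R^-1 * \sum_i X i j ^+ 2 <= m2).

(** The squared weights that turn independent noise of variance proxy g into an
    entry of X^T xi / n. *)
Lemma column_weight_le j (g : R) : 0 <= g ->
  (\sum_i (n%:R^-1 * X i j) ^+ 2) * g <= g * m2 / n%:R.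
Proof.
move=> g0; under eq_bigr do rewrite exprMn.
rewrite -mulr_sumr mulrC -mulrA ler_wpM2l// expr2 -mulrA mulrC.
by rewrite ler_wpM2r// invr_ge0.
Qed.

Lemma sqrt_proxy (g L : R) : 0 <= g ->
  Num.sqrt (2 * (g ^+ 2 * m2 / n%:R) * L) = g * Num.sqrt (2 * m2 * L / n%:R).
Proof.
move=> g0; rewrite -[in RHS](ger0_norm g0) -sqrtr_sqr -sqrtrM ?sqr_ge0//.
by congr Num.sqrt; ring.
Qed.

Let m20 : (0 < p)%N -> 0 <= m2.
Proof.
move=> p0; apply: le_trans (Xm2 (Ordinal p0)); rewrite mulr_ge0// ?invr_ge0//.
by apply: sumr_ge0 => i _; exact: sqr_ge0.
Qed.

Lemma design_response_noise_tail sigma (xi : T -> 'cV[R]_n) eps :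
  (0 < p)%N -> 0 <= sigma -> 0 < eps < 1 ->
  measurable_fun setT xi -> response_noise P sigma xi ->
  prob_ge P [set w | `|n%:R^-1 *: (X^T *m xi w)| <= delta2 sigma m2 n p eps]
    (1 - eps).
Proof.
move=> p0 sigma0 eps01 mxi Hxi.
rewrite /delta2 /linear_rate -sqrt_proxy// -[p in 2 * p%:R](muln1 p).
apply: mx_norm_tail => //.
- apply: measurable_mxZ; apply: measurable_mxM => //; exact: measurable_cst.
- by rewrite divr_ge0// mulr_ge0 ?sqr_ge0// m20.
move=> j k; rewrite (ord1 k).
have := le_variance_proxy (column_weight_le j (sqr_ge0 sigma))
  (response_noise_sum (fun i => n%:R^-1 * X i j) mxi Hxi).
congr (variance_proxy P _ _); apply/funext => w.
by rewrite !mxE mulr_sumr; apply: eq_bigr => i _; rewrite !mxE mulrA.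
Qed.

Lemma design_noise_proxy sigmaW (xi : T -> 'cV[R]_n) (W : T -> 'M[R]_(n, p))
    (theta : 'cV[R]_p) j :
  measurable_fun setT W -> design_noise P sigmaW xi W ->
  variance_proxy P ((sigmaW * lnorm 2%:E theta) ^+ 2 * m2 / n%:R)
    (fun w => (n%:R^-1 *: (X^T *m W w *m theta)) j 0).
Proof.
move=> mW HW.
have g0 := sqr_ge0 (sigmaW * lnorm 2%:E theta); rewrite exprMn in g0 *.
have := le_variance_proxy (column_weight_le j g0)
  (design_noise_sum (fun i => n%:R^-1 * X i j) theta mW HW).
congr (variance_proxy P _ _); apply/funext => w.
rewrite -mulmxA mxE [in RHS]mxE mulr_sumr; apply: eq_bigr => i _.
by rewrite -row_mul !mxE mulrA.
Qed.

Lemma design_noise_theta_tail sigmaW (xi : T -> 'cV[R]_n)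
    (W : T -> 'M[R]_(n, p)) (theta : 'cV[R]_p) eps :
  (0 < p)%N -> 0 <= sigmaW -> 0 < eps < 1 ->
  measurable_fun setT W -> design_noise P sigmaW xi W ->
  prob_ge P [set w | `|n%:R^-1 *: (X^T *m W w *m theta)| <=
     delta1' sigmaW m2 n p eps * lnorm 2%:E theta] (1 - eps).
Proof.
move=> p0 sigma0 eps01 mW HW.
rewrite /delta1' /linear_rate mulrAC -sqrt_proxy ?mulr_ge0 ?lnorm_ge0//.
rewrite -[p in 2 * p%:R](muln1 p).
apply: mx_norm_tail => //.
- apply: measurable_mxZ; apply: measurable_mxM; last exact: measurable_cst.
  by apply: measurable_mxM => //; exact: measurable_cst.
- by rewrite divr_ge0// mulr_ge0 ?sqr_ge0// m20.
by move=> j k; rewrite (ord1 k); exact: (design_noise_proxy theta j mW HW).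
Qed.

Lemma design_noise_tail sigmaW (xi : T -> 'cV[R]_n)
    (W : T -> 'M[R]_(n, p)) eps :
  (0 < p)%N -> 0 <= sigmaW -> 0 < eps < 1 ->
  measurable_fun setT W -> design_noise P sigmaW xi W ->
  prob_ge P [set w | `|n%:R^-1 *: (X^T *m W w)| <=
     delta1 sigmaW m2 n p eps] (1 - eps).
Proof.
move=> p0 sigma0 eps01 mW HW.
rewrite /delta1 -sqrt_proxy//.
apply: mx_norm_tail => //.
- by apply: measurable_mxZ; apply: measurable_mxM => //; exact: measurable_cst.
- by rewrite divr_ge0// mulr_ge0 ?sqr_ge0// m20.
move=> j k.
have norm1 : lnorm 2%:E (delta_mx k 0 : 'cV[R]_p) = 1.
  rewrite lnorm2E (bigD1 k)//= mxE !eqxx/= expr1n big1 ?addr0 ?sqrtr1//.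
  by move=> i ik; rewrite mxE (negbTE ik)/= expr0n.
have := design_noise_proxy (delta_mx k 0) j mW HW.
rewrite norm1 mulr1; congr (variance_proxy P _ _); apply/funext => w.
by rewrite scalemxAl -colE mxE.
Qed.

End design_tails.

Section estimator.
Context d (T : measurableType d) (R : realType) (P : probability T R).

(** Stated for diagonal matrices, the form in which this deviation is added to
    that of Diag(W^T W) / n. *)
Lemma var_estimator_prob_ge cb cb' n p (W : T -> 'M[R]_(n, p))
    (sig2 : T -> 'rV[R]_p) eps :
  measurable_fun setT sig2 -> var_estimator P cb cb' W sig2 -> 0 < eps ->
  1 <= cb' * p%:R / eps ->
  prob_ge P [set w | `|diag_mx (noise_var P W) - diag_mx (sig2 w)| <=
     var_rate cb cb' n p eps] (1 - eps).
Proof.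
move=> msig H eps0 arg1; have {H} := H eps eps0 arg1.
set b := var_rate _ _ _ _ _ => Hb.
have mD : measurable [set w | `|diag_mx (noise_var P W) - diag_mx (sig2 w)| <= b].
  apply: measurable_mx_norm_le; apply: measurable_mxD; first exact: measurable_cst.
  exact/measurable_mxN/measurable_diag_mx.
apply: prob_geC => //; apply: le_trans Hb; apply: le_measure; rewrite ?inE.
- exact: measurableC.
- rewrite -[X in measurable X]setTI.
  rewrite -[[set w | _]]/((fun w => `|sig2 w - noise_var P W|) @^-1`
    [set x | b <= x]).
  rewrite -set_itvcy; apply: measurable_mx_norm => //.
  by apply: measurable_mxD => //; exact: measurable_cst.
move=> w /= /negP; rewrite -real_ltNge ?num_real// => /ltW /le_trans; apply.
apply/mx_norm_leP => // i j; rewrite -linearB/= mxE.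
case: eqP => _ /=; last by rewrite normr0.
rewrite mulr1n; have := le_mx_norm (sig2 w - noise_var P W) 0 i.
by rewrite !mxE distrC.
Qed.

End estimator.

Section noise_event_probability.
Context {R : realType}.

(** The bound of [noise_event] on the corrected diagonal is the sum of two
    deviations around the true variances, which is why there are eight events
    for seven inequalities. *)
Lemma noise_law_event (gamma0 t0 : R -> R -> R) (gamma2 t2 : R -> R)
    (hconst : noise_constants gamma0 t0 gamma2 t2)
    (m2 sigma sigmaW cb cb' eps : R) (n p : nat) (X : 'M[R]_(n, p))
    (thetas : 'cV[R]_p)
    (Q : probability ('cV[R]_n * 'M[R]_(n, p) * 'rV[R]_p)%type R) :
  0 <= sigma -> 0 <= sigmaW -> (0 < n)%N -> (0 < p)%N -> 0 < eps < 1 ->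
  1 <= cb' * p%:R / eps ->
  (forall j, n%:R^-1 * \sum_i X i j ^+ 2 <= m2) ->
  noise_law sigma sigmaW cb cb' Q ->
  prob_ge Q [set e | noise_event X e.1.2 e.1.1 e.2 thetas
     (delta1 sigmaW m2 n p eps) (delta1' sigmaW m2 n p eps)
     (delta2 sigma m2 n p eps)
     (delta3 (gamma0 sigma sigmaW) (t0 sigma sigmaW) n p eps)
     (delta4 (gamma0 sigma sigmaW) (t0 sigma sigmaW) n p eps)
     (delta4' (gamma2 sigmaW) (t2 sigmaW) n p eps)
     (delta5 (gamma0 sigma sigmaW) (t0 sigma sigmaW) n p eps
        + var_rate cb cb' n p eps)]
   (1 - 8 * eps).
Proof.
move=> sigma0 sigmaW0 n0 p0 eps01 arg1 Xm2 [Hxi HW Hsig].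
have eps0 : 0 < eps by case/andP: eps01.
have mxi : measurable_fun setT
    (fun e : 'cV[R]_n * 'M[R]_(n, p) * 'rV[R]_p => e.1.1).
  exact: (measurableT_comp measurable_fst measurable_fst).
have mW : measurable_fun setT
    (fun e : 'cV[R]_n * 'M[R]_(n, p) * 'rV[R]_p => e.1.2).
  exact: (measurableT_comp measurable_snd measurable_fst).
have msig : measurable_fun setT
    (fun e : 'cV[R]_n * 'M[R]_(n, p) * 'rV[R]_p => e.2).
  exact: measurable_snd.
pose E := ('cV[R]_n * 'M[R]_(n, p) * 'rV[R]_p)%type.
pose fxi (e : E) := e.1.1; pose fW (e : E) := e.1.2.
pose bxi := @isMeasurableFun.Build _ _ E 'cV[R]_n fxi mxi.
pose bW := @isMeasurableFun.Build _ _ E 'M[R]_(n, p) fW mW.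
pose xi : {RV Q >-> 'cV[R]_n} := HB.pack_for {mfun E >-> 'cV[R]_n} fxi bxi.
pose W : {RV Q >-> 'M[R]_(n, p)} := HB.pack_for {mfun E >-> 'M[R]_(n, p)} fW bW.
have [_ _ _ _ hc] := hconst sigma sigmaW sigma0 sigmaW0.
have [h3 h4 h5 h4'] := hc n p eps _ _ Q xi W thetas n0 p0 eps01 Hxi HW.
have hb := var_estimator_prob_ge msig Hsig eps0 arg1.
have h2 := design_response_noise_tail Xm2 p0 sigma0 eps01 mxi Hxi.
have h1' := design_noise_theta_tail Xm2 thetas p0 sigmaW0 eps01 mW HW.
have h1 := design_noise_tail Xm2 p0 sigmaW0 eps01 mW HW.
have := prob_geI h2 (prob_geI h3 (prob_geI h1 (prob_geI h1' (prob_geI h4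
  (prob_geI h4' (prob_geI h5 hb)))))).
rewrite (_ : eps + _ = 8 * eps); last by ring.
apply: prob_geS => e [e2 [e3 [e1 [e1' [e4 [e4' [e5 eb]]]]]]].
split => //.
rewrite /= in e5 eb *.
have := le_trans (ler_normD _ _) (lerD e5 eb).
by rewrite addrA subrK.
Qed.

End noise_event_probability.

(** * Integrating over the design *)

Section disintegration.
Local Open Scope ereal_scope.
Context d d1 d2 (T : measurableType d) (R : realType) (P : probability T R)
  (T1 : measurableType d1) (T2 : measurableType d2).
Variables (X : {RV P >-> T1}) (Y : {RV P >-> T2}) (K : T1 -> probability T2 R).
Hypothesis XYK : conditional_distribution X Y K.

Let XY w := (X w, Y w).

Let mXY : measurable_fun setT XY.
Proof. exact: measurable_fun_pair. Qed.

Let mpreXY E : measurable E -> measurable (XY @^-1` E).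
Proof. by move=> mE; rewrite -[X in measurable X]setTI; exact: mXY. Qed.

Let phi (E : set (T1 * T2)) x := K x (xsection E x).

Let good := [set E | [/\ measurable E, measurable_fun setT (phi E) &
  P (XY @^-1` E) = \int[distribution P X]_x phi E x]].

Let phi0 E x : 0 <= phi E x. Proof. exact: measure_ge0. Qed.

(** A conditional distribution is defined by its action on rectangles; the sets
    for which the disintegration formula holds form a lambda-system, and the
    rectangles are a pi-system generating the product sigma-algebra. *)
Lemma conditional_distribution_xsection (E : set (T1 * T2)) : measurable E ->
  measurable_fun setT (fun x => K x (xsection E x)) /\
  P [set w | E (X w, Y w)] =
    \int[distribution P X]_x K x (xsection E x).
Proof.
move=> mE; suff : good E by case.
suff : measurable `<=` good by exact.
rewrite measurable_prod_measurableType.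
set C := [set A `*` B | A in measurable & B in measurable].
have CI : setI_closed C.
  move=> _ _ [X1 mX1 [X2 mX2 <-]] [Y1 mY1 [Y2 mY2 <-]].
  exists (X1 `&` Y1); first exact: measurableI.
  by exists (X2 `&` Y2); [exact: measurableI|rewrite setXI].
have CT : C setT by exists setT => //; exists setT => //; rewrite setXTT.
have Cgood : C `<=` good.
  move=> _ [A mA [B mB <-]].
  have phiE : phi (A `*` B) = (fun x => K x B) \_ A.
    apply/funext => x; rewrite /phi patchE; case: ifPn => xA.
      by rewrite in_xsectionX.
    by rewrite notin_xsectionX// measure0.
  have mphi : measurable_fun setT (phi (A `*` B)).
    rewrite phiE; apply/(measurable_restrictT _ mA).
    by apply: measurable_funTS; exact: XYK.1.
  split => //; first exact: measurableX.
  by rewrite phiE -integral_mkcond -XYK.2.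
suff : lambda_system setT good by move=> ?; exact: lambda_system_subset.
split => //; first exact: Cgood.
- move=> A B BA [mA mphiA PA] [mB mphiB PB].
  have phiD : phi (A `\` B) = fun x => phi A x - phi B x.
    apply/funext => x; rewrite /phi xsectionD// measureD//.
    + by rewrite setIidr//; exact: le_xsection.
    + exact: measurable_xsection.
    + exact: measurable_xsection.
    + by apply: le_lt_trans (probability_le1 _ _) (ltry _);
        exact: measurable_xsection.
  have mphiD : measurable_fun setT (phi (A `\` B)).
    by rewrite phiD; exact: emeasurable_funB.
  have mD : measurable (A `\` B) by exact: measurableD.
  split => //.
  have intA : \int[distribution P X]_x phi A x =
      \int[distribution P X]_x phi (A `\` B) x
      + \int[distribution P X]_x phi B x.
    rewrite -ge0_integralD//; apply: eq_integral => x _.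
    rewrite phiD subeK// fin_num_measure//; exact: measurable_xsection.
  rewrite -PA -PB in intA.
  have : P (XY @^-1` A) = P (XY @^-1` (A `\` B)) + P (XY @^-1` B).
    rewrite -measureU//; try exact: mpreXY.
      by rewrite -preimage_setU setUC setDUK.
    by rewrite -preimage_setI setDKI preimage_set0.
  have PBfin : P (XY @^-1` B) \is a fin_num.
    by rewrite fin_num_measure//; exact: mpreXY.
  by rewrite intA => /(congr1 (fun u => u - P (XY @^-1` B))); rewrite !addeK.
- move=> F ndF goodF.
  have mF i : measurable (F i) by have [] := goodF i.
  have mphiF i : measurable_fun setT (phi (F i)) by have [] := goodF i.
  have mU : measurable (\bigcup_i F i) by exact: bigcupT_measurable.
  have cphi x : phi (F i) x @[i \oo] --> phi (\bigcup_i F i) x.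
    rewrite /phi xsection_bigcup; apply: nondecreasing_cvg_mu.
    + by move=> n; exact: measurable_xsection.
    + by apply: bigcupT_measurable => i; exact: measurable_xsection.
    + by move=> m n mn; exact/subsetPset/le_xsection/subsetPset/ndF.
  have mphiU : measurable_fun setT (phi (\bigcup_i F i)).
    by apply: (emeasurable_fun_cvg (fun i => phi (F i))) => // x _; exact: cphi.
  split => //.
  have c1 : P (XY @^-1` F i) @[i --> \oo] --> P (XY @^-1` \bigcup_i F i).
    rewrite preimage_bigcup; apply: nondecreasing_cvg_mu.
    + by move=> n; exact: mpreXY.
    + by apply: bigcupT_measurable => i; exact: mpreXY.
    + move=> m n mn; apply/subsetPset => w /=.
      by have /subsetPset := ndF _ _ mn; apply.
  have c2 : P (XY @^-1` F i) @[i --> \oo] -->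
      \int[distribution P X]_x phi (\bigcup_i F i) x.
    have -> : (fun i => P (XY @^-1` F i)) =
        (fun i => \int[distribution P X]_x phi (F i) x).
      by apply/funext => i; have [] := goodF i.
    rewrite (_ : \int[_]_x phi _ x =
        \int[distribution P X]_x limn (fun i => phi (F i) x)); last first.
      by apply: eq_integral => x _; apply/esym/cvg_lim => //; exact: cphi.
    apply: cvg_monotone_convergence => //.
    move=> x _ m n mn.
    apply: le_measure; rewrite ?inE; try exact: measurable_xsection.
    exact/le_xsection/subsetPset/ndF.
  by move/cvg_lim : c1 => <- //; move/cvg_lim : c2 => <-.
Qed.

End disintegration.

(** Integrating over B gives at least (1 - a) (1 - b) >= 1 - (a + b). *)
Lemma conditional_distribution_prob_ge d d1 d2 (T : measurableType d)
    (R : realType) (P : probability T R) (T1 : measurableType d1)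
    (T2 : measurableType d2) (X : {RV P >-> T1}) (Y : {RV P >-> T2})
    (K : T1 -> probability T2 R) (B : set T1) (E : set (T1 * T2)) (a b : R) :
  conditional_distribution X Y K -> measurable B -> measurable E ->
  (((1 - a)%:E) <= distribution P X B)%E -> 0 <= a -> 0 <= b <= 1 ->
  (forall x, B x -> prob_ge (K x) [set y | E (x, y)] (1 - b)) ->
  prob_ge P [set w | B (X w) /\ E (X w, Y w)] (1 - (a + b)).
Proof.
move=> XYK mB mE PB a0 /andP[b0 b1] KE.
pose F := (B `*` setT) `&` E.
have mF : measurable F by apply: measurableI => //; exact: measurableX.
have [mK PF] := conditional_distribution_xsection XYK mF.
exists [set w | F (X w, Y w)]; split.
- rewrite -[X in measurable X]setTI.
  by apply: (measurable_fun_pair (f := X) (g := Y)).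
- by move=> w [[]].
rewrite PF; apply: (@le_trans _ _ ((1 - b)%:E * distribution P X B)%E).
  apply: (@le_trans _ _ ((1 - b)%:E * (1 - a)%:E)%E).
    by rewrite -EFinM lee_fin; nra.
  by apply: lee_wpmul2l => //; rewrite lee_fin subr_ge0.
have -> : distribution P X B = (\int[distribution P X]_x (\1_B x)%:E)%E.
  by rewrite integral_indic// setIT.
rewrite -ge0_integralZl//; last 2 first.
  by apply/measurable_EFinP; exact: measurable_indic.
  by rewrite lee_fin subr_ge0.
apply: ge0_le_integral => //.
- by move=> x _; rewrite mule_ge0// lee_fin// subr_ge0.
- by apply: measurable_funeM; apply/measurable_EFinP; exact: measurable_indic.
move=> x _; rewrite indicE; have [xB|xB] := boolP (x \in B); last first.
  by rewrite mule0 measure_ge0.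
rewrite mule1; rewrite inE in xB.
have [C [mC CE PC]] := KE x xB.
apply: (le_trans PC); apply: le_measure; rewrite ?inE//.
  exact: measurable_xsection.
by move=> y /CE Ey; rewrite /xsection/= inE.
Qed.

(** * Comparison of the noise levels with one rate *)

Section rate_bounds.
Context {R : realType}.

(** The common rate: under the assumptions of this part every noise level is at
    most a constant times it. *)
Definition basic_rate (n p : nat) (eps : R) := Num.sqrt (ln (p%:R / eps) / n%:R).

(** Each of the five summands bounds one kind of noise level.  The factor 4
    leaves room for the largest combination of levels in the analysis, where
    1 / lambda <= 2 and twice [delta1] occur. *)
Definition rate_constant (m2 sigma sigmaW g0 u0 g2 u2 cb cb' : R) : R :=
  4 * (sigmaW * Num.sqrt (6 * m2) + sigma * Num.sqrt (6 * m2)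
       + (2 * g0 + 4 / u0) + (2 * g2 + 4 / u2) + cb * Num.sqrt (cb' + 1)).

(** A crude bound that makes ln 9 >= 1. *)
Lemma expR1_le4 : expR 1 <= 4 :> R.
Proof.
have : 2^-1 <= expR (- 2^-1) :> R by apply: le_trans (expR_ge1Dx _); lra.
rewrite expRN lef_pV2 ?posrE ?expR_gt0// => e2.
have -> : expR 1 = expR 2^-1 * expR 2^-1 :> R.
  by rewrite -expRD; congr expR; field.
rewrite (_ : 4 = 2 * 2); last by ring.
by rewrite ler_pM// ltW// expR_gt0.
Qed.

Lemma rate_constant_gt0 (m2 sigma sigmaW g0 u0 g2 u2 cb cb' : R) :
  0 <= sigma -> 0 <= sigmaW -> 0 < g0 -> 0 < u0 -> 0 < g2 -> 0 < u2 ->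
  0 < cb -> 0 < rate_constant m2 sigma sigmaW g0 u0 g2 u2 cb cb'.
Proof.
move=> sigma0 sigmaW0 g00 u00 g20 u20 cb0; rewrite mulr_gt0//.
have aW0 : 0 <= sigmaW * Num.sqrt (6 * m2) by rewrite mulr_ge0// sqrtr_ge0.
have aX0 : 0 <= sigma * Num.sqrt (6 * m2) by rewrite mulr_ge0// sqrtr_ge0.
have aB0 : 0 < 2 * g0 + 4 / u0 by rewrite addr_gt0 ?mulr_gt0 ?invr_gt0.
have aB'0 : 0 < 2 * g2 + 4 / u2 by rewrite addr_gt0 ?mulr_gt0 ?invr_gt0.
have aE0 : 0 <= cb * Num.sqrt (cb' + 1) by rewrite mulr_ge0 ?sqrtr_ge0// ltW.
by rewrite ltr_wpDr// addr_gt0// ltr_wpDl// addr_ge0.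
Qed.

Variables (n p : nat) (eps : R).
Hypotheses (n0 : (0 < n)%N) (p0 : (0 < p)%N) (eps0 : 0 < eps)
  (eps9 : 9 * eps < 1).

Let x := p%:R / eps.
Let l := ln x.
Let r := basic_rate n p eps.

Let p1 : 1 <= p%:R :> R. Proof. by rewrite ler1n. Qed.

Let nR : 0 < n%:R :> R. Proof. by rewrite ltr0n. Qed.

Let x9 : 9 <= x.
Proof. by rewrite /x ler_pdivlMr// (le_trans (ltW eps9)). Qed.

Let x0 : 0 < x. Proof. by apply: lt_le_trans x9. Qed.

(** This is where eps < 1/9 enters: it excludes the case p = 1, eps near 1, in
    which ln (p / eps) would not dominate ln 2. *)
Lemma ln_ratio_ge1 : 1 <= l.
Proof.
rewrite /l -ler_expR lnK ?posrE//; apply: le_trans expR1_le4 _.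
by apply: le_trans x9; lra.
Qed.

(** A nonpositive y is allowed because [ln] vanishes there, as in [delta4] for
    p = 1. *)
Lemma ln_le_ratio k y : y <= x ^+ k.+1 -> ln y <= k.+1%:R * l.
Proof.
move=> yx; rewrite mulr_natl -lnXn//.
have [y0|y0] := leP y 0; last by rewrite ler_ln ?posrE// exprn_gt0.
rewrite ln0// ln_ge0//; apply: exprn_ege1.
by apply: le_trans x9; lra.
Qed.

Lemma ln_2p : ln (2 * p%:R / eps) <= 2 * l.
Proof.
apply: (ln_le_ratio (k := 1)); rewrite -mulrA -/x expr2 ler_wpM2r ?ltW//.
by apply: lt_le_trans x9; lra.
Qed.

Lemma ln_2pp : ln (2 * (p * p)%:R / eps) <= 3 * l.
Proof.
apply: (ln_le_ratio (k := 2)).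
have -> : 2 * (p * p)%:R / eps = (2 * eps) * x ^+ 2.
  by rewrite natrM /x; field; rewrite gt_eqF.
rewrite [leRHS]exprS ler_wpM2r ?exprn_ge0// ?ltW//.
by apply: lt_le_trans x9; move: eps9; lra.
Qed.

Lemma ln_pp1 : ln (p%:R * (p%:R - 1) / eps) <= 2 * l.
Proof.
apply: (ln_le_ratio (k := 1)).
have -> : x ^+ 2 = p%:R * p%:R / eps * eps^-1.
  by rewrite /x; field; rewrite gt_eqF.
rewrite -[leLHS]mulr1; apply: ler_pM => //.
- by rewrite divr_ge0 ?(ltW eps0)// mulr_ge0// subr_ge0.
- rewrite ler_pM2r ?invr_gt0// ler_wpM2l//; lra.
- by rewrite invf_ge1//; move: eps9 eps0; lra.
Qed.

Lemma ln_cp c : 0 < c -> ln (c * p%:R / eps) <= (c + 1) * l.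
Proof.
move=> c0; rewrite -mulrA -/x lnM ?posrE// mulrDl mul1r lerD2r.
apply: (@le_trans _ _ c); first exact/ltW/ln_sublinear.
by rewrite ler_peMr ?ln_ratio_ge1// ltW.
Qed.

Lemma basic_rate_sqr : r ^+ 2 = l / n%:R.
Proof.
rewrite sqr_sqrtr// divr_ge0//; apply: le_trans ln_ratio_ge1; exact: ler01.
Qed.

Lemma sqrt_le_basic_rate k L : 0 <= k -> L <= k * l ->
  Num.sqrt (L / n%:R) <= Num.sqrt k * r.
Proof.
move=> k0 Lk; rewrite -sqrtrM// ler_wsqrtr// mulrA ler_pM2r//.
by rewrite invr_gt0.
Qed.

Lemma subgaussian_le_basic_rate g m2 L : 0 <= g -> 0 <= m2 -> L <= 3 * l ->
  g * Num.sqrt (2 * m2 * L / n%:R) <= g * Num.sqrt (6 * m2) * r.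
Proof.
move=> g0 m20 L3; rewrite -[leRHS]mulrA ler_wpM2l//; apply: sqrt_le_basic_rate.
  by rewrite mulr_ge0.
rewrite (_ : 6 * m2 * l = 2 * m2 * (3 * l)); last by ring.
by rewrite ler_wpM2l// mulr_ge0.
Qed.

(** The second branch is of order r^2, hence of order r once r <= 1. *)
Lemma bernstein_le_basic_rate g u L : 0 < g -> 0 < u -> r <= 1 -> L <= 2 * l ->
  bernstein_rate g u n L <= (2 * g + 4 / u) * r.
Proof.
move=> g0 u0 r1 L2; have r0 : 0 <= r by exact: sqrtr_ge0.
have u4 : 0 <= 4 / u by rewrite divr_ge0// ltW.
rewrite /bernstein_rate ge_max; apply/andP; split.
  apply: (@le_trans _ _ (g * (Num.sqrt 4 * r))).
    rewrite ler_pM2l//; apply: sqrt_le_basic_rate => //.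
    by rewrite (_ : 4 = 2 * 2) -?mulrA ?ler_pM2l//; ring.
  have -> : Num.sqrt 4 = 2 :> R.
    by rewrite (_ : 4 = 2 ^+ 2) ?sqrtr_sqr ?ger0_norm//; ring.
  by rewrite mulrA [g * 2]mulrC ler_wpM2r// lerDl.
apply: (@le_trans _ _ (4 / u * r ^+ 2)).
  rewrite basic_rate_sqr.
  have -> : 4 / u * (l / n%:R) = 2 / (u * n%:R) * (2 * l).
    by field; rewrite !gt_eqF.
  have -> : 2 * L / (u * n%:R) = 2 / (u * n%:R) * L.
    by field; rewrite !gt_eqF.
  by rewrite ler_wpM2l// divr_ge0// mulr_ge0// ltW.
apply: (@le_trans _ _ (4 / u * r)).
  by rewrite ler_wpM2l// expr2 ler_piMr.
by rewrite ler_wpM2r// lerDr mulr_ge0// ltW.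
Qed.

Lemma var_rate_le_basic_rate cb cb' : 0 < cb -> 0 < cb' ->
  var_rate cb cb' n p eps <= cb * Num.sqrt (cb' + 1) * r.
Proof.
move=> cb0 cb0'; rewrite /var_rate -[leRHS]mulrA ler_pM2l//.
by apply: sqrt_le_basic_rate; [rewrite addr_ge0// ltW|exact: ln_cp].
Qed.

(** Here lambda^-1 + lambda >= 2. *)
Lemma sparsity_basic_rate (c1 lambda : R) s : 2^-1 <= lambda <= 2 -> 0 <= c1 ->
  s%:R <= c1 * (lambda^-1 + lambda)^-1 * Num.sqrt (n%:R / ln (p%:R / eps)) ->
  s%:R * r <= c1 / 2.
Proof.
move=> /andP[lam1 lam2] c10 Hs.
have lam0 : 0 < lambda by apply: lt_le_trans lam1; rewrite invr_gt0.
have r0 : 0 < r.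
  rewrite sqrtr_gt0 divr_gt0//; apply: lt_le_trans ln_ratio_ge1; exact: ltr01.
have rE : Num.sqrt (n%:R / ln (p%:R / eps)) = r^-1.
  rewrite /r /basic_rate -sqrtrV ?invf_div// divr_ge0//.
  by apply: le_trans ln_ratio_ge1; exact: ler01.
rewrite rE in Hs; rewrite -ler_pdivlMr//; apply: (le_trans Hs).
rewrite ler_pM2r ?invr_gt0// ler_wpM2l// lef_pV2 ?posrE ?addr_gt0 ?invr_gt0//.
rewrite -subr_ge0 (_ : _ - 2 = lambda^-1 * (lambda - 1) ^+ 2).
  by rewrite mulr_ge0 ?sqr_ge0// invr_ge0 ltW.
by field; rewrite gt_eqF.
Qed.

Lemma noise_levels_le (m2 sigma sigmaW g0 u0 g2 u2 cb cb' lambda : R) :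
  0 < m2 -> 0 <= sigma -> 0 <= sigmaW -> 0 < g0 -> 0 < u0 -> 0 < g2 ->
  0 < u2 -> 0 < cb -> 0 < cb' -> 2^-1 <= lambda -> r <= 1 ->
  let A := rate_constant m2 sigma sigmaW g0 u0 g2 u2 cb cb' in
  let d5 := delta5 g0 u0 n p eps + var_rate cb cb' n p eps in
  let mu := delta1' sigmaW m2 n p eps + delta4' g2 u2 n p eps + d5 in
  [/\ 0 <= mu, mu <= A * r,
      delta2 sigma m2 n p eps + delta3 g0 u0 n p eps <= A * r &
      mu * lambda^-1 + 2 * delta1 sigmaW m2 n p eps
        + delta4 g0 u0 n p eps + d5 <= A * r].
Proof.
move=> m20 sigma0 sigmaW0 g00 u00 g20 u20 cb0 cb'0 lam r1 A d5 mu.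
have r0 : 0 <= r by exact: sqrtr_ge0.
have ln2p3 : ln (2 * p%:R / eps) <= 3 * l.
  apply: le_trans ln_2p _; rewrite ler_wpM2r//; last by rewrite ler_nat.
  by apply: le_trans ln_ratio_ge1; exact: ler01.
have rate1 : delta1 sigmaW m2 n p eps <= sigmaW * Num.sqrt (6 * m2) * r.
  by apply: subgaussian_le_basic_rate => //; [exact: ltW|exact: ln_2pp].
have rate1' : delta1' sigmaW m2 n p eps <= sigmaW * Num.sqrt (6 * m2) * r.
  by apply: subgaussian_le_basic_rate => //; exact: ltW.
have rate2 : delta2 sigma m2 n p eps <= sigma * Num.sqrt (6 * m2) * r.
  by apply: subgaussian_le_basic_rate => //; exact: ltW.
have rate3 : delta3 g0 u0 n p eps <= (2 * g0 + 4 / u0) * r.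
  by apply: bernstein_le_basic_rate => //; exact: ln_2p.
have rate4 : delta4 g0 u0 n p eps <= (2 * g0 + 4 / u0) * r.
  by apply: bernstein_le_basic_rate => //; exact: ln_pp1.
have rate4' : delta4' g2 u2 n p eps <= (2 * g2 + 4 / u2) * r.
  by apply: bernstein_le_basic_rate => //; exact: ln_2p.
have rateb : var_rate cb cb' n p eps <= cb * Num.sqrt (cb' + 1) * r.
  exact: var_rate_le_basic_rate.
have pos1' : 0 <= delta1' sigmaW m2 n p eps by rewrite mulr_ge0// sqrtr_ge0.
have pos4' : 0 <= delta4' g2 u2 n p eps.
  by rewrite le_max mulr_ge0 ?sqrtr_ge0// ltW.
have pos3 : 0 <= delta3 g0 u0 n p eps.
  by rewrite le_max mulr_ge0 ?sqrtr_ge0// ltW.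
have posb : 0 <= var_rate cb cb' n p eps by rewrite mulr_ge0 ?sqrtr_ge0// ltW.
have mu0 : 0 <= mu by rewrite !addr_ge0.
have lam2 : mu * lambda^-1 <= mu * 2.
  apply: ler_wpM2l => //; rewrite -[leRHS]invrK lef_pV2// posrE ?invr_gt0//.
  by apply: lt_le_trans lam; rewrite invr_gt0.
have posW : 0 <= sigmaW * Num.sqrt (6 * m2) * r.
  by rewrite !mulr_ge0// sqrtr_ge0.
have posX : 0 <= sigma * Num.sqrt (6 * m2) * r.
  by rewrite !mulr_ge0// sqrtr_ge0.
have posB : 0 <= (2 * g0 + 4 / u0) * r by exact: le_trans rate3.
have posB' : 0 <= (2 * g2 + 4 / u2) * r by exact: le_trans rate4'.
have posE : 0 <= cb * Num.sqrt (cb' + 1) * r by exact: le_trans rateb.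
have -> : A * r = 4 * (sigmaW * Num.sqrt (6 * m2) * r
    + sigma * Num.sqrt (6 * m2) * r + (2 * g0 + 4 / u0) * r
    + (2 * g2 + 4 / u2) * r + cb * Num.sqrt (cb' + 1) * r).
  by rewrite /A /rate_constant; ring.
have mu_le : mu <= sigmaW * Num.sqrt (6 * m2) * r + (2 * g2 + 4 / u2) * r
    + ((2 * g0 + 4 / u0) * r + cb * Num.sqrt (cb' + 1) * r).
  by do 2 apply: lerD => //; exact: lerD.
have d5_le : d5 <= (2 * g0 + 4 / u0) * r + cb * Num.sqrt (cb' + 1) * r.
  exact: lerD.
move: mu0 lam2 mu_le d5_le rate1 rate2 rate3 rate4 posW posX posB posB' posE.
move: (mu / lambda) (mu) (d5) (delta1 _ _ _ _ _) (delta2 _ _ _ _ _)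
  (delta3 _ _ _ _ _) (delta4 _ _ _ _ _).
move: (sigmaW * Num.sqrt (6 * m2) * r) (sigma * Num.sqrt (6 * m2) * r)
  ((2 * g0 + 4 / u0) * r) ((2 * g2 + 4 / u2) * r) (cb * Num.sqrt (cb' + 1) * r).
by move=> bW bX bB bB' bE mulam nu e5 e1 e2 e3 e4 *; split; lra.
Qed.

End rate_bounds.

(** * Estimation and prediction bounds *)

Theorem corollary1 (R : realType)
  (gamma0 t0 : R -> R -> R) (gamma2 t2 : R -> R)
  (hconst : noise_constants gamma0 t0 gamma2 t2)
  (m2 sigma sigmaW cb cb' c : R)
  (hm2 : 0 < m2) (hsigma : 0 <= sigma) (hsigmaW : 0 <= sigmaW)
  (hcb : 0 < cb) (hcb' : 0 < cb') (hc : 0 < c) :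
  exists C c' c1max : R, [/\ 0 < C, 0 < c', 0 < c1max &
  forall (c1 : R) (n p s : nat) (q : \bar R) (eps lambda : R)
    (Omega : set 'M[R]_(n, p)) (Theta : set 'cV[R]_p) (thetas : 'cV[R]_p)
    (d : measure_display) (T : measurableType d) (P : probability T R)
    (X : {RV P >-> 'M[R]_(n, p)})
    (N : {RV P >-> ('cV[R]_n * 'M[R]_(n, p) * 'rV[R]_p)%type})
    (K : 'M[R]_(n, p) ->
           probability ('cV[R]_n * 'M[R]_(n, p) * 'rV[R]_p)%type R)
    (thetahat : T -> 'cV[R]_p) (that : T -> R),
  let xi w := (N w).1.1 in
  let W w := (N w).1.2 in
  let sig2hat w := (N w).2 in
  let y w := X w *m thetas + xi w in
  let Z w := X w + W w in
  let g0 := gamma0 sigma sigmaW in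
  let u0 := t0 sigma sigmaW in
  let mu := delta1' sigmaW m2 n p eps
            + delta4' (gamma2 sigmaW) (t2 sigmaW) n p eps
            + delta5 g0 u0 n p eps + var_rate cb cb' n p eps in
  let tau := delta2 sigma m2 n p eps + delta3 g0 u0 n p eps in
  0 < c1 <= c1max ->
  (0 < n)%N -> (1 <= s <= p)%N -> (1 <= q)%E ->
  0 < eps < 1 -> 2^-1 <= lambda <= 2 ->
  1 <= cb' * p%:R / eps ->
  design_class q s eps c lambda m2 Omega (distribution P X) ->
  conditional_distribution X N K ->
  (forall x, Omega x -> noise_law sigma sigmaW cb cb' (K x)) ->
  Theta thetas -> (nnz thetas <= s)%N ->
  s%:R <= c1 * (lambda^-1 + lambda)^-1 * Num.sqrt (n%:R / ln (p%:R / eps)) ->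
  (forall w, conic_solution Theta (y w) (Z w) (sig2hat w) mu tau lambda
               (thetahat w) (that w)) ->
  prob_ge P
    [set w |
       lnorm q (thetahat w - thetas)
         <= C * s%:R `^ (fine q^-1%E)
            * Num.sqrt (ln (c' * p%:R / eps) / n%:R)
            * (lnorm 2%:E thetas + 1)
     /\ n%:R^-1 * lnorm 2%:E (X w *m (thetahat w - thetas)) ^+ 2
         <= C * s%:R * (ln (c' * p%:R / eps) / n%:R)
            * (lnorm 2%:E thetas + 1) ^+ 2]
    (1 - 9 * eps)].
Proof.
have [g00 u00 g20 u20 _] := hconst sigma sigmaW hsigma hsigmaW.
set g0 := gamma0 sigma sigmaW in g00 *; set u0 := t0 sigma sigmaW in u00 *.
set g2 := gamma2 sigmaW in g20 *; set u2 := t2 sigmaW in u20 *.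
pose A := rate_constant m2 sigma sigmaW g0 u0 g2 u2 cb cb'.
have A0 : 0 < A by exact: rate_constant_gt0.
have AE : A = rate_constant m2 sigma sigmaW g0 u0 g2 u2 cb cb' by [].
clearbody A.
(* The two terms of C come from the two bounds of [conic_error]; the threshold
   for c1 gives r <= 1 and 8 A (s r) <= c, both through s r <= c1 / 2. *)
exists (4 * A / c + 64 * A ^+ 2 / c), 1, (Num.min 2 (c / (4 * A))); split => //.
- by apply: addr_gt0; apply: divr_gt0 => //; apply: mulr_gt0 => //;
    exact: exprn_gt0.
- by rewrite lt_min ltr0n/= divr_gt0// mulr_gt0.
move=> c1 n p s q eps lambda Omega Theta thetas d T P X N K thetahat that.
move=> xi W sig2hat y Z g0' u0' mu tau /andP[c10 c1max] n0 /andP[s0 sp] q1.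
move=> eps01 lam arg1 Hdesign HK Hlaw Ttrue nnzs Hs Hsol.
case/andP: (eps01) => eps0 eps1.
(* a nonpositive probability bound is met by the empty set *)
have [eps9|eps9] := leP 1 (9 * eps).
  by exists set0; split => //; rewrite measure0 lee_fin subr_le0.
have p0 : (0 < p)%N by exact: leq_trans sp.
have [B [mB BX PB]] := Hdesign.
pose r := basic_rate n p eps.
have r0 : 0 <= r by exact: sqrtr_ge0.
have sr : s%:R * r <= c1 / 2.
  by apply: (sparsity_basic_rate n0 p0 eps0 eps9 lam (ltW c10) Hs).
move: c1max; rewrite le_min => /andP[c12 c1A].
have r1 : r <= 1.
  apply: (@le_trans _ _ (s%:R * r)); first by rewrite ler_peMl// ler1n.
  by apply: (le_trans sr); clear -c12; lra.
have sr' : 8 * A * (s%:R * r) <= c.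
  apply: (@le_trans _ _ (8 * A * (c1 / 2))).
    by rewrite ler_wpM2l// mulr_ge0// ltW.
  move: c1A; rewrite ler_pdivlMr ?mulr_gt0// => c1A.
  by move: c1A; rewrite (_ : 8 * A * (c1 / 2) = c1 * (4 * A))//; field.
have HE := @measurable_noise_event R n p thetas (delta1 sigmaW m2 n p eps)
  (delta1' sigmaW m2 n p eps)
  (delta2 sigma m2 n p eps) (delta3 g0 u0 n p eps) (delta4 g0 u0 n p eps)
  (delta4' g2 u2 n p eps) (delta5 g0 u0 n p eps + var_rate cb cb' n p eps).
have eps8 : 0 <= 8 * eps <= 1 by clear -eps0 eps9; apply/andP; split; lra.
have := conditional_distribution_prob_ge HK mB HE PB (ltW eps0) eps8.
rewrite (_ : eps + 8 * eps = 9 * eps); last by ring.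
have KE x : B x -> prob_ge (K x) [set e | noise_event x e.1.2 e.1.1 e.2 thetas
    (delta1 sigmaW m2 n p eps) (delta1' sigmaW m2 n p eps)
    (delta2 sigma m2 n p eps) (delta3 g0 u0 n p eps) (delta4 g0 u0 n p eps)
    (delta4' g2 u2 n p eps)
    (delta5 g0 u0 n p eps + var_rate cb cb' n p eps)] (1 - 8 * eps).
  move=> /BX [_ Xm2 Om]; exact: (noise_law_event hconst thetas hsigma hsigmaW
    n0 p0 eps01 arg1 Xm2 (Hlaw x Om)).
move=> /(_ KE); apply: prob_geS => w [/BX [Hsens Xm2 Om] Hnoise].
have mu_split : mu = delta1' sigmaW m2 n p eps + delta4' g2 u2 n p eps
    + (delta5 g0 u0 n p eps + var_rate cb cb' n p eps) by rewrite /mu addrA.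
have := Hsol w; rewrite mu_split => sol.
have := noise_levels_le n0 p0 eps0 eps9 hm2 hsigma hsigmaW g00 u00 g20 u20
  hcb hcb' (andP lam).1 r1.
rewrite /= -AE => -[mu0 muA tauA rhoA].
have := conic_error Hnoise sol Ttrue s0 nnzs q1 lam hc (ltW A0) r0 Hsens.
rewrite mu0 muA => /(_ isT tauA rhoA sr') [err pred].
have L0 : 0 <= lnorm 2%:E thetas + 1 by rewrite addr_ge0// lnorm_ge0.
have C1 : 4 * A / c <= 4 * A / c + 64 * A ^+ 2 / c.
  by rewrite lerDl divr_ge0 ?(ltW hc)// mulr_ge0// exprn_ge0// ltW.
have C2 : 64 * A ^+ 2 / c <= 4 * A / c + 64 * A ^+ 2 / c.
  by rewrite lerDr divr_ge0 ?(ltW hc)// mulr_ge0// ltW.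
rewrite mul1r; split.
  by apply: (le_trans err); do 3 (apply: ler_wpM2r => //); exact: powR_ge0.
apply: (le_trans pred).
rewrite (basic_rate_sqr n p0 eps0 eps9) ler_wpM2r ?exprn_ge0//.
rewrite ler_wpM2r ?ler_wpM2r//.
rewrite divr_ge0//; apply: le_trans (ln_ratio_ge1 p0 eps0 eps9); exact: ler01.
Qed.
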